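(* Let $X=\{0,1,2,3\}$ and let $G$ be the group generated by the transformations $e_1,e_2,e_3$ of $X^\ast\cup X^\infty$ defined recursively by $e_i(0w)=i\,e_i(w)$, $e_i(iw)=0w$, $e_i(jw)=jw$ for $j\notin\{0,i\}$. Let $\Gamma$ be any infinite Schreier graph of $G$, i.e. for some $w\in X^\infty$ the graph whose vertex set is the $G$-orbit of $w$ and with an edge joining $v$ and $e_i(v)$ for each vertex $v$ and each $i\in\{1,2,3\}$. Define $Q_1=\{\sqrt{14}\}$, $Q_{m+1}=\{\sqrt{12+sq}: q\in Q_m,\ s\in\{1,-1\}\}$, and $R_n=\{2+sq: q\in Q_n,\ s\in\{1,-1\}\}$ for $n\ge1$ (the points of the form $2\pm\sqrt{12\pm\sqrt{12\pm\cdots\pm\sqrt{14}}}$ with $n$ radicals). Then the spectrum of (the adjacency operator of) $\Gamma$ is the closure of $\{4\}\cup\bigcup_{n\ge1}R_n$. This set is the union of a Cantor set of zero Lebesgue measure which is symmetric about $2$ and a countable collection of isolated points supporting the KNS spectral measure $\mu$; $\mu$ is discrete, with $\mu(\{x\})=\frac{1}{2\cdot 4^n}$ for each $x\in R_n$, $n\ge1$, and $\mu(\{4\})=\frac12$.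
   Context: The adjacency operator of $\Gamma$ acts on $\ell^2$ of the vertex set, with loops (at fixed points of $e_i$) contributing $2$ to the diagonal entry. Let $\Gamma_n$ be the finite Schreier graph on $X^n$ (same edge rule) and $A_n=\sum_{i=1}^3(M_i+M_i^{T})$ its adjacency matrix, $M_i$ the permutation matrix of $e_i$ on $X^n$. The KNS (Kesten–Neumann–Serre) spectral measure $\mu$ is the weak limit as $n\to\infty$ of the counting measures $\mu_n=4^{-n}\sum_{\lambda}\delta_{\lambda}$, the sum running over the eigenvalues of $A_n$ with multiplicity. *)

(* Defs.v *)
From HB Require Import structures.
From Stdlib Require Import Relations.
From mathcomp Require Import all_boot all_order all_algebra.
From mathcomp Require Import all_classical all_reals all_analysis.
Set Implicit Arguments. Unset Strict Implicit. Unset Printing Implicit Defensive.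
Import Order.TTheory GRing.Theory Num.Theory.
Import numFieldNormedType.Exports.
Local Open Scope classical_set_scope.
Local Open Scope ring_scope.

Definition word := nat -> 'I_4.

(* generator index i : 'I_3 stands for e_(i+1); its letter is i+1 *)
Definition letter (i : 'I_3) : 'I_4 := lift ord0 i.

(* e_i on infinite words: e_i(0w)=i e_i(w), e_i(iw)=0w, e_i(jw)=jw.
   Position m is modified iff all previous letters are 0. *)
Definition e (i : 'I_3) (w : word) : word := fun m =>
  if [forall k : 'I_m, w k == ord0] then
    (if w m == ord0 then letter i else if w m == letter i then ord0 else w m)
  else w m.

(* the inverse transformation e_i^{-1}: e_i^{-1}(iw)=0 e_i^{-1}(w),
   e_i^{-1}(0w)=iw, e_i^{-1}(jw)=jw *)
Definition einv (i : 'I_3) (w : word) : word := fun m =>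
  if [forall k : 'I_m, w k == letter i] then
    (if w m == letter i then ord0 else if w m == ord0 then letter i else w m)
  else w m.

(* G-orbit of w: equivalence closure of the relation v ~ e_i v
   (the e_i are bijections, so this is exactly {g w | g in G}). *)
Definition sorbit (w : word) : set word :=
  [set v | clos_refl_sym_trans word (fun x y => exists i, y = e i x) w v].

Definition l2 {R : realType} (w : word) (f : word -> R) : Prop :=
  (forall v, ~ sorbit w v -> f v = 0) /\
  (\esum_(v in sorbit w) ((f v) ^+ 2)%:E < +oo)%E.

(* adjacency operator: (A f)(v) = sum_i (f(e_i v) + f(e_i^{-1} v));
   a loop at v (e_i v = v) contributes 2 f(v) *)
Definition adj {R : realType} (f : word -> R) (v : word) : R :=
  \sum_(i < 3) (f (e i v) + f (einv i v)).

Definition in_spectrum {R : realType} (w : word) (l : R) : Prop :=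
  ~ (forall g : word -> R, l2 w g ->
       exists! f : word -> R, l2 w f /\ (fun v => adj f v - l * f v) = g).

Definition fword (n : nat) := {ffun 'I_n -> 'I_4}.

Definition ef (n : nat) (i : 'I_3) (u : fword n) : fword n := [ffun m : 'I_n =>
  if [forall k : 'I_n, (k < m)%N ==> (u k == ord0)] then
    (if u m == ord0 then letter i else if u m == letter i then ord0 else u m)
  else u m].

Definition An {R : realType} (n : nat) : 'M[R]_(#|{: fword n}|) :=
  \matrix_(a, b) \sum_(i < 3)
     (((ef i (enum_val a) == enum_val b) : nat)%:R
      + ((ef i (enum_val b) == enum_val a) : nat)%:R).

Definition eigen_list {R : realType} (n : nat) (s : seq R) : Prop :=
  char_poly (@An R n) = \prod_(x <- s) ('X - x%:P).

Definition Qstep {R : realType} (s : seq R) : seq R :=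
  flatten [seq [:: Num.sqrt (12 + q); Num.sqrt (12 - q)] | q <- s].

Fixpoint Q {R : realType} (n : nat) : seq R :=
  match n with
  | 0 => [::]
  | 1 => [:: Num.sqrt 14]
  | m.+1 => Qstep (Q m)
  end.

Definition Rn {R : realType} (n : nat) : seq R :=
  flatten [seq [:: 2 + q; 2 - q] | q <- @Q R n].

Definition Rset {R : realType} : set R :=
  [set 4] `|` [set x | exists2 n, (1 <= n)%N & x \in @Rn R n].

(* integral of f against the discrete measure
   mu = 1/2 delta_4 + sum_{n>=1} sum_{x in R_n} 1/(2*4^n) delta_x *)
Definition kns_int {R : realType} (f : R -> R) : R :=
  f 4 / 2 + limn (fun N => \sum_(1 <= n < N) (\sum_(x <- @Rn R n) f x) / (2 * 4 ^+ n)).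

Definition cantor_set {R : realType} (C : set R) : Prop :=
  [/\ C !=set0, compact C, perfect_set C & totally_disconnected C].

(* Main.v *)
(* Deleting the words that start with a nonzero letter (a Schur complement)
   turns [A - l] on the graph of [w], for [l <> 4], into [A - renorm l] on the
   graph of the shifted word, where [renorm l = l^2 - 4 l - 6], that is
   [x |-> x^2 - 12] in the coordinate [x = l - 2].  So [l] is in the resolvent
   set as soon as its orbit avoids [4] and escapes to where [A] is dominated by
   [l]; the other [l] are the iterated preimages of [4], which form [Rset], and
   the Julia set of [renorm].  Each preimage of [4] has a finitely supported
   functional annihilating the range of [A - l], lifted from the 2-cycle
   [02u, 12u] of the graph; a gliding hump along such preimages handles the
   Julia set without any appeal to the closedness of the spectrum.  The two
   inverse branches of [renorm] contract by a factor at least [4], whence a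
   Cantor set of measure zero.  The same Schur complement gives
   [char_poly A_(n+1) = (X - 4)^(2 * 4^n) * (char_poly A_n \Po renorm)], hence
   the multiplicities and the limit of the counting measures. *)

Require Import Defs.
From HB Require Import structures.
From Stdlib Require Import Relations.
From mathcomp Require Import all_boot all_order all_algebra.
From mathcomp Require Import all_classical all_reals all_analysis.
From mathcomp Require Import perm ring lra zify.
Import Order.TTheory GRing.Theory Num.Theory.
Import numFieldNormedType.Exports.
Local Open Scope classical_set_scope.
Local Open Scope ring_scope.
Set Implicit Arguments. Unset Strict Implicit. Unset Printing Implicit Defensive.

(** * The action on infinite words *)

Definition wcons (j : 'I_4) (v : word) : word :=
  fun m => if m is k.+1 then v k else j.

Definition wtail (w : word) : word := fun m => w m.+1.

Lemma wcons_wtail (w : word) : wcons (w 0%N) (wtail w) = w.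
Proof. by apply/funext => -[]. Qed.

Lemma wcons_inj (j : 'I_4) : injective (wcons j).
Proof. by move=> u v /(congr1 wtail). Qed.

Lemma forall_prefix_wcons (j c : 'I_4) (v : word) (m : nat) :
  [forall k : 'I_m.+1, wcons j v k == c] =
  (j == c) && [forall k : 'I_m, v k == c].
Proof.
apply/forallP/andP => [h|[jc /forallP h] [[|k] km]//].
  split; first exact: (h ord0).
  by apply/forallP => k; exact: (h (lift ord0 k)).
by have := h (Ordinal (km : (k < m)%N)).
Qed.

Lemma letter_neq0 (i : 'I_3) : (letter i == ord0) = false.
Proof. by []. Qed.

Lemma letter_inj : injective letter.
Proof. exact: lift_inj. Qed.

Lemma letterP (j : 'I_4) : j = ord0 \/ exists i, j = letter i.
Proof.
case: (unliftP ord0 j) => [i ->|->]; last by left.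
by right; exists i.
Qed.

(** Recovers the defining recursion from the positionwise encoding: a prefix condition on
    [wcons j v] splits into a condition on [j] and the same condition on [v]. *)
Lemma e_wcons (i : 'I_3) (j : 'I_4) (v : word) :
  e i (wcons j v) = if j == ord0 then wcons (letter i) (e i v)
                    else if j == letter i then wcons ord0 v else wcons j v.
Proof.
apply/funext => -[|m]; rewrite /e.
  have -> : [forall k : 'I_0, wcons j v k == ord0] by apply/forallP => -[].
  by rewrite /=; do 2?case: ifP.
by rewrite forall_prefix_wcons /=; case: (j == ord0) => //=; case: ifP.
Qed.

Lemma einv_wcons (i : 'I_3) (j : 'I_4) (v : word) :
  einv i (wcons j v) = if j == letter i then wcons ord0 (einv i v)
                    else if j == ord0 then wcons (letter i) v else wcons j v.
Proof.
apply/funext => -[|m]; rewrite /einv.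
  have -> : [forall k : 'I_0, wcons j v k == letter i] by apply/forallP => -[].
  by rewrite /=; do 2?case: ifP.
by rewrite forall_prefix_wcons /=; case: (j == letter i) => //=; case: ifP.
Qed.

(** The recursion on words never bottoms out, so equality is checked letter by letter, by induction
    on the position for all words at once. *)
Lemma eK (i : 'I_3) : cancel (e i) (einv i).
Proof.
move=> w; apply/funext => m; elim: m w => [|m IH] w;
  rewrite -(wcons_wtail w); move: (w 0%N) (wtail w) => j v {w};
  rewrite e_wcons; (case: (eqVneq j ord0) => [->|j0];
    first by rewrite einv_wcons eqxx /=);
  (case: (eqVneq j (letter i)) => [->|ji]; first by rewrite einv_wcons);
  by rewrite einv_wcons (negPf j0) (negPf ji).
Qed.

Lemma einvK (i : 'I_3) : cancel (einv i) (e i).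
Proof.
move=> w; apply/funext => m; elim: m w => [|m IH] w;
  rewrite -(wcons_wtail w); move: (w 0%N) (wtail w) => j v {w};
  rewrite einv_wcons; (case: (eqVneq j (letter i)) => [->|ji];
    first by rewrite e_wcons eqxx /=);
  (case: (eqVneq j ord0) => [->|j0]; first by rewrite e_wcons eqxx);
  by rewrite e_wcons (negPf j0) (negPf ji).
Qed.

Lemma e_wcons0 (i : 'I_3) (v : word) :
  e i (wcons ord0 v) = wcons (letter i) (e i v).
Proof. by rewrite e_wcons. Qed.

Lemma e_wcons_letter (i : 'I_3) (v : word) :
  e i (wcons (letter i) v) = wcons ord0 v.
Proof. by rewrite e_wcons eqxx. Qed.

Lemma sorbit_refl (w : word) : sorbit w w.
Proof. exact: rst_refl. Qed.

Lemma sorbit_e (w v : word) (i : 'I_3) : sorbit w v -> sorbit w (e i v).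
Proof. by move=> wv; apply: rst_trans wv _; apply: rst_step; exists i. Qed.

Lemma sorbit_einv (w v : word) (i : 'I_3) : sorbit w v -> sorbit w (einv i v).
Proof.
move=> wv; apply: rst_trans wv _; apply/rst_sym/rst_step; exists i.
by rewrite einvK.
Qed.

Lemma sorbit_sym (w v : word) : sorbit w v -> sorbit v w.
Proof. exact: rst_sym. Qed.

Lemma sorbit_trans (u v w : word) : sorbit u v -> sorbit v w -> sorbit u w.
Proof. exact: rst_trans. Qed.

Lemma sorbit_wcons0 (j : 'I_4) (v : word) : sorbit (wcons j v) (wcons ord0 v).
Proof.
case: (letterP j) => [->|[i ->]]; first exact: sorbit_refl.
by rewrite -(e_wcons_letter i v); exact/sorbit_e/sorbit_refl.
Qed.

(** Within an orbit the first letter can be exchanged for [0], and behind a [0] each generator acts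
    on the tail. With [sorbit_wtail] this identifies the words of an orbit with pairs of a letter
    and a word of the orbit of the tail. *)
Lemma sorbit_wcons (j k : 'I_4) (u v : word) :
  sorbit u v -> sorbit (wcons j u) (wcons k v).
Proof.
move=> uv; apply: (sorbit_trans (sorbit_wcons0 _ _)).
apply: sorbit_trans (sorbit_sym (sorbit_wcons0 k v)).
elim: uv => {u v} [u _ [i ->]|u|u v _|u v t _ uv _]; last exact: sorbit_trans.
- apply: sorbit_trans (sorbit_wcons0 (letter i) _).
  by rewrite -e_wcons0; exact/sorbit_e/sorbit_refl.
- exact: sorbit_refl.
- exact: sorbit_sym.
Qed.

Lemma sorbit_wtail (u v : word) : sorbit u v -> sorbit (wtail u) (wtail v).
Proof.
elim=> {u v} [u _ [i ->]|u|u v _|u v t _ uv _]; last exact: sorbit_trans.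
- rewrite -{2}(wcons_wtail u) e_wcons; case: ifP => _.
    by apply: sorbit_e; exact: sorbit_refl.
  by case: ifP => _; exact: sorbit_refl.
- exact: sorbit_refl.
- exact: sorbit_sym.
Qed.

Lemma sorbit_wconsE (w v : word) (j : 'I_4) :
  sorbit w (wcons j v) <-> sorbit (wtail w) v.
Proof.
split=> [/sorbit_wtail//|wv]; rewrite -(wcons_wtail w).
exact: sorbit_wcons.
Qed.

Lemma sorbit_cofinal (n : nat) (w v : word) :
  (forall m, (n <= m)%N -> v m = w m) -> sorbit w v.
Proof.
elim: n w v => [|n IH] w v vw.
  by have -> : v = w; [apply/funext => m; exact: vw|exact: sorbit_refl].
rewrite -(wcons_wtail v); apply/sorbit_wconsE; apply: IH => m nm.
exact: vw.
Qed.

Lemma adj_wcons0 (R : realType) (F : word -> R) (v : word) :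
  adj F (wcons ord0 v) =
  \sum_(i < 3) (F (wcons (letter i) (e i v)) + F (wcons (letter i) v)).
Proof. by apply: eq_bigr => i _; rewrite e_wcons einv_wcons. Qed.

(** The coefficient 4 comes from the two generators other than [e i]: each fixes the word, and each
    loop counts 2. This is where the exceptional spectral value 4 originates. *)
Lemma adj_wcons_letter (R : realType) (F : word -> R) (i : 'I_3) (v : word) :
  adj F (wcons (letter i) v) =
  4 * F (wcons (letter i) v) + F (wcons ord0 v) + F (wcons ord0 (einv i v)).
Proof.
rewrite /adj (bigD1 i)//= e_wcons_letter einv_wcons eqxx.
rewrite (eq_bigr (fun=> 2 * F (wcons (letter i) v))) => [|k ki].
  by rewrite sumr_const cardC1 card_ord -mulr_natr /=; ring.
rewrite e_wcons einv_wcons letter_neq0 (inj_eq letter_inj) eq_sym (negPf ki).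
by rewrite mulr_natl.
Qed.

(* The Schur complement of [adj - l] with respect to the words starting with
   a nonzero letter, multiplied by [l - 4]. *)
Definition schur (R : realType) (l : R) (F : word -> R) (v : word) : R :=
  (l - 4) * F (wcons ord0 v)
  + \sum_(i < 3) (F (wcons (letter i) (e i v)) + F (wcons (letter i) v)).

Definition renorm (R : realType) (l : R) : R := l ^+ 2 - 4 * l - 6.

(** The factors [l - 4] and [4 - l] cancel all values of [F] at words with a nonzero first letter.
    Six of the surviving terms are returns to [wcons ord0 v]; they turn [l * (l - 4)] into
    [l * (l - 4) - 6], which is [renorm l]. *)
Lemma schurE (R : realType) (l : R) (F : word -> R) (v : word) :
  schur l (fun u => adj F u - l * F u) v =
  adj (fun u => F (wcons ord0 u)) v - renorm l * F (wcons ord0 v).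
Proof.
rewrite /schur adj_wcons0.
under [X in _ + X = _]eq_bigr => i _ do rewrite !adj_wcons_letter eK.
rewrite /adj /renorm !big_ord_recr !big_ord0 /=; ring.
Qed.

(** * Square summable functions and the Schur complement *)

(** The squared norm is bounded through finite sums over all words, with an explicit real constant
    that can be followed through operators and pointwise limits. *)
Definition sqb (R : realType) (M : R) (f : word -> R) : Prop :=
  forall s : seq word, uniq s -> \sum_(v <- s) f v ^+ 2 <= M.

Definition sqf (R : realType) (f : word -> R) : Prop := exists M, sqb M f.

Lemma sqb_ge0 (R : realType) (M : R) (f : word -> R) : sqb M f -> 0 <= M.
Proof. by move=> /(_ [::] isT); rewrite big_nil. Qed.

Lemma sqb_point (R : realType) (M : R) (f : word -> R) (v : word) :
  sqb M f -> f v ^+ 2 <= M.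
Proof. by move=> /(_ [:: v] isT); rewrite big_seq1. Qed.

Lemma sqb_comp (R : realType) (M : R) (f : word -> R) (phi : word -> word) :
  injective phi -> sqb M f -> sqb M (f \o phi).
Proof.
move=> phiI fM s us; have := fM (map phi s).
by rewrite map_inj_uniq// big_map; exact.
Qed.

Lemma sqbD (R : realType) (M N : R) (f g : word -> R) :
  sqb M f -> sqb N g -> sqb (2 * M + 2 * N) (f \+ g).
Proof.
move=> fM gN s us; apply: (@le_trans _ _ (\sum_(v <- s) (2 * f v ^+ 2 + 2 * g v ^+ 2))).
  by apply: ler_sum => v _ /=; have := sqr_ge0 (f v - g v); nra.
by rewrite big_split -!mulr_sumr lerD// ler_pM2l// ?fM ?gN.
Qed.

Lemma sqbZ (R : realType) (M c : R) (f : word -> R) :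
  sqb M f -> sqb (c ^+ 2 * M) (fun v => c * f v).
Proof.
move=> fM s us; under eq_bigr do rewrite exprMn.
by rewrite -mulr_sumr ler_wpM2l ?sqr_ge0 ?fM.
Qed.

(** Cauchy-Schwarz for six terms gives one factor 6, and the six terms, each [f] composed with an
    injection, give the other. *)
Lemma sqb_adj (R : realType) (M : R) (f : word -> R) :
  sqb M f -> sqb (36 * M) (adj f).
Proof.
move=> fM s us.
have fe i : \sum_(v <- s) f (e i v) ^+ 2 <= M.
  exact: (sqb_comp (can_inj (eK i)) fM us).
have fi i : \sum_(v <- s) f (einv i v) ^+ 2 <= M.
  exact: (sqb_comp (can_inj (einvK i)) fM us).
apply: (@le_trans _ _ (\sum_(v <- s)
    6 * \sum_(i < 3) (f (e i v) ^+ 2 + f (einv i v) ^+ 2))).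
  apply: ler_sum => v _; rewrite /adj !big_ord_recr !big_ord0 /=.
  move: (f (e _ v)) (f (einv _ v)) (f (e _ v)) (f (einv _ v)) (f (e _ v))
    (f (einv _ v)) => a b c d x y.
  have := sqr_ge0 (a - b); have := sqr_ge0 (a - c); have := sqr_ge0 (a - d).
  have := sqr_ge0 (a - x); have := sqr_ge0 (a - y); have := sqr_ge0 (b - c).
  have := sqr_ge0 (b - d); have := sqr_ge0 (b - x); have := sqr_ge0 (b - y).
  have := sqr_ge0 (c - d); have := sqr_ge0 (c - x); have := sqr_ge0 (c - y).
  have := sqr_ge0 (d - x); have := sqr_ge0 (d - y); have := sqr_ge0 (x - y).
  by rewrite !expr2; lra.
rewrite -mulr_sumr exchange_big (_ : 36 * M = 6 * (6 * M)); last by ring.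
rewrite ler_pM2l//; apply: (@le_trans _ _ (\sum_(i < 3) (M + M))).
  by apply: ler_sum => i _; rewrite big_split lerD.
by rewrite sumr_const card_ord -mulr_natr le_eqVlt; apply/orP; left; apply/eqP; ring.
Qed.

Lemma sqfD (R : realType) (f g : word -> R) : sqf f -> sqf g -> sqf (f \+ g).
Proof. by move=> [M fM] [N gN]; exists (2 * M + 2 * N); exact: sqbD. Qed.

Lemma sqfZ (R : realType) (c : R) (f : word -> R) :
  sqf f -> sqf (fun v => c * f v).
Proof. by move=> [M fM]; exists (c ^+ 2 * M); exact: sqbZ. Qed.

Lemma sqf_comp (R : realType) (f : word -> R) (phi : word -> word) :
  injective phi -> sqf f -> sqf (f \o phi).
Proof. by move=> phiI [M fM]; exists M; exact: sqb_comp. Qed.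

Lemma sqf_sum (R : realType) (n : nat) (F : 'I_n -> word -> R) :
  (forall i, sqf (F i)) -> sqf (fun v => \sum_(i < n) F i v).
Proof.
elim: n F => [|n IH] F FM.
  exists 0 => s _; rewrite big1// => v _; rewrite big_ord0 expr0n //.
under eq_fun => v do rewrite big_ord_recr /=.
by apply: sqfD => //; apply: IH => i.
Qed.

Lemma sqf_wcons (R : realType) (f : word -> R) :
  (forall j, sqf (fun v => f (wcons j v))) -> sqf f.
Proof.
move=> /choice[M fM]; exists (\sum_j M j) => s us.
rewrite (partition_big (fun v => v 0%N) xpredT)//=.
apply: ler_sum => j _; rewrite -big_filter.
have <- : [seq wcons j (wtail v) | v <- s & v 0%N == j] =
          [seq v <- s | v 0%N == j].
  rewrite -[RHS]map_id; apply/eq_in_map => v; rewrite mem_filter.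
  by case/andP => /eqP <- _; rewrite wcons_wtail.
rewrite map_comp (big_map (wcons j)); apply: fM.
rewrite map_inj_in_uniq ?filter_uniq// => u v.
rewrite !mem_filter => /andP[/eqP u0 _] /andP[/eqP v0 _] uv.
by rewrite -(wcons_wtail u) uv u0 -v0 wcons_wtail.
Qed.

Lemma l2P (R : realType) (w : word) (f : word -> R) :
  l2 w f <-> (forall v, ~ sorbit w v -> f v = 0) /\ sqf f.
Proof.
split=> -[f0 fM]; split=> //.
  exists (fine (\esum_(v in sorbit w) (f v ^+ 2)%:E)) => s us.
  rewrite -lee_fin fineK; last first.
    rewrite ge0_fin_numE//; apply: esum_ge0 => v _.
    by rewrite lee_fin sqr_ge0.
  apply: esum_ge; exists [set` [seq v <- s | `[< sorbit w v >]]].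
    split; first exact: finite_seq.
    by move=> v /=; rewrite mem_filter => /andP[/asboolP].
  rewrite -fsbig_seq ?filter_uniq// big_filter sumEFin lee_fin.
  rewrite (bigID (fun v => `[< sorbit w v >]))/= [X in _ + X]big1 ?addr0//.
  by move=> v /asboolP /f0 ->; rewrite expr0n.
case: fM => M fM; apply: (@le_lt_trans _ _ M%:E); last exact: ltry.
apply: ge_ereal_sup => _ [X [finX _] <-].
rewrite fsbig_finite// sumEFin lee_fin; apply: fM; exact: finmap.fset_uniq.
Qed.

(** This is the statement that [in_spectrum] negates: [adj - l] is a bijection of l^2 of the
    orbit. *)
Definition in_resolvent (R : realType) (w : word) (l : R) : Prop :=
  forall g : word -> R, l2 w g ->
    exists! f : word -> R, l2 w f /\ (fun v => adj f v - l * f v) = g.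

Lemma l2_wtail (R : realType) (w : word) (f : word -> R) (j : 'I_4) :
  l2 w f -> l2 (wtail w) (fun v => f (wcons j v)).
Proof.
move=> /l2P[f0 fM]; apply/l2P; split=> [v wv|]; last first.
  exact: (sqf_comp (@wcons_inj j) fM).
by apply: f0 => /sorbit_wconsE.
Qed.

Lemma l2_schur (R : realType) (w : word) (l : R) (f : word -> R) :
  l2 w f -> l2 (wtail w) (schur l f).
Proof.
move=> l2f; have /l2P[_ s0] := l2_wtail ord0 l2f; apply/l2P; split.
  have /l2P[f0 _] := l2f; move=> v wv; rewrite /schur f0 => [|/sorbit_wconsE//].
  rewrite mulr0 add0r big1// => i _.
  rewrite !f0 ?addr0// => /sorbit_wconsE// /(sorbit_einv i).
  by rewrite eK.
apply: sqfD; first exact: sqfZ.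
apply: sqf_sum => i; have /l2P[_ si] := l2_wtail (letter i) l2f.
apply: sqfD => //; exact: (sqf_comp (can_inj (eK i)) si).
Qed.

(** Block elimination: the equation reduces to one for the values at words starting with [0], solved
    by hypothesis on the shifted orbit; the other values follow by back substitution. Uniqueness
    holds since every solution restricts to a solution of the reduced equation. *)
Lemma resolvent_wtail (R : realType) (w : word) (l : R) :
  l != 4 -> in_resolvent (wtail w) (renorm l) -> in_resolvent w l.
Proof.
move=> l4 bl g l2g; have l40 : l - 4 != 0 by rewrite subr_eq0.
have [a [[l2a aE] aU]] := bl _ (l2_schur l l2g).
(* At words with a nonzero first letter the value is forced by the equation at that very word. *)
pose F (u : word) : R :=
  if unlift ord0 (u 0%N) is Some i then
    (a (wtail u) + a (einv i (wtail u)) - g u) / (l - 4)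
  else a (wtail u).
have F0 v : F (wcons ord0 v) = a v by rewrite /F /= unlift_none.
have Fl i v : F (wcons (letter i) v) =
    (a v + a (einv i v) - g (wcons (letter i) v)) / (l - 4).
  by rewrite /F /= liftK.
have FE : (fun v => adj F v - l * F v) = g.
  have Fi i v : adj F (wcons (letter i) v) - l * F (wcons (letter i) v) =
      g (wcons (letter i) v).
    by rewrite adj_wcons_letter !F0 !Fl; field.
  apply/funext => u; rewrite -(wcons_wtail u).
  move: (u 0%N) (wtail u) => j v {u}.
  case: (letterP j) => [->|[i ->]]; last exact: Fi.
  (* After scaling by [l - 4] and adding the equations already known at nonzero letters, both sides
     are Schur complements, so [schurE] reduces the claim to the equation for [a]. *)
  apply: (mulfI l40); apply: (addIr (\sum_(i < 3)
    (g (wcons (letter i) (e i v)) + g (wcons (letter i) v)))).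
  have := schurE l F v; rewrite /schur.
  under [X in _ + X = _]eq_bigr => i _ do rewrite !Fi.
  move=> ->; rewrite -[RHS]/(schur l g v) -aE F0.
  by under [in LHS]eq_fun => u do rewrite F0.
have l2F : l2 w F.
  have /l2P[a0 aM] := l2a; have /l2P[g0 gM] := l2g; apply/l2P; split.
    move=> u; rewrite -(wcons_wtail u); move: (u 0%N) (wtail u) => j v {u}.
    move=> wv; have wv' : ~ sorbit (wtail w) v by move=> /sorbit_wconsE.
    case: (letterP j) wv => [->|[i ->]] wv; first by rewrite F0 a0.
    rewrite Fl a0// a0 ?g0 ?addr0 ?subr0 ?mul0r// => /(sorbit_e i).
    by rewrite einvK.
  apply: sqf_wcons => j; case: (letterP j) => [->|[i ->]].
    by under eq_fun => v do rewrite F0.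
  under eq_fun => v do rewrite Fl mulrC.
  apply: sqfZ; apply: sqfD.
    by apply: sqfD => //; exact: (sqf_comp (can_inj (einvK i)) aM).
  have /(sqfZ (-1)) := sqf_comp (@wcons_inj (letter i)) gM.
  by under eq_fun => v do rewrite mulN1r.
exists F; split=> // F' [l2F' F'E].
have aF' : a = (fun v => F' (wcons ord0 v)).
  apply: aU; split; first exact: l2_wtail.
  by apply/funext => v; rewrite -schurE F'E.
apply/funext => u; rewrite -(wcons_wtail u).
move: (u 0%N) (wtail u) => j v {u}.
case: (letterP j) => [->|[i ->]]; first by rewrite F0 aF'.
rewrite Fl; apply: (mulIf l40); rewrite mulfVK//.
have /(congr1 (fun h => h (wcons (letter i) v))) := F'E.
by rewrite adj_wcons_letter aF' => <-; ring.
Qed.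

Lemma le0_of_natmul_le (R : realType) (x M : R) :
  (forall n : nat, x * n%:R <= M) -> x <= 0.
Proof.
move=> xM; rewrite leNgt; apply/negP => x0.
have M0 : 0 <= M by have := xM 0%N; rewrite mulr0.
have := xM (Num.bound (M / x)); apply/negP; rewrite -ltNge mulrC -ltr_pdivrMr//.
by rewrite archi_boundP// divr_ge0// ltW.
Qed.

Lemma natr_le_exp4 (R : realType) (n : nat) : n%:R <= 4 ^+ n :> R.
Proof. by rewrite -natrX ler_nat ltnW// ltn_expl. Qed.

Lemma adj_eq0 (R : realType) (w : word) (f : word -> R) :
  (forall v, ~ sorbit w v -> f v = 0) ->
  forall v, ~ sorbit w v -> adj f v = 0.
Proof.
move=> f0 v wv; rewrite /adj big1// => i _.
rewrite !f0 ?addr0// => [/(sorbit_e i)|/(sorbit_einv i)].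
  by rewrite einvK.
by rewrite eK.
Qed.

(** The threshold ensures [36 / l^2 <= 1/4], so [l^-1 * adj] at least halves the norm. A large
    threshold costs nothing, since escaping orbits are unbounded. *)
Lemma sqb_adj_div (R : realType) (l M : R) (f : word -> R) : 100 <= `|l| ->
  sqb M f -> sqb (M / 4) (fun v => l^-1 * adj f v).
Proof.
move=> l100 fM s us; have := sqbZ l^-1 (sqb_adj fM) us => /le_trans; apply.
have l2 : 10000 <= l ^+ 2.
  by rewrite -real_normK ?num_real//; nra.
have lV : l^-1 ^+ 2 * 144 <= 1 by rewrite exprVn mulrC ler_pdivrMr; lra.
by have := sqb_ge0 fM; nra.
Qed.

(** An eigenfunction is fixed by the contraction [l^-1 * adj], so its squared norm is bounded by
    [M / 4 ^+ n] for every [n]. *)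
Lemma adj_eigen_eq0 (R : realType) (l : R) (f : word -> R) : 100 <= `|l| ->
  sqf f -> (forall v, adj f v = l * f v) -> forall v, f v = 0.
Proof.
move=> l100 [M fM] fE v.
have l0 : l != 0 by rewrite -normr_gt0 (lt_le_trans _ l100).
have fn n : sqb (M / 4 ^+ n) f.
  elim: n => [|n IH]; first by rewrite divr1.
  have -> : f = (fun v => l^-1 * adj f v).
    by apply/funext => u; rewrite fE mulKf.
  by rewrite exprSr invfM mulrA; exact: sqb_adj_div.
apply/eqP; rewrite -sqrf_eq0 eq_le sqr_ge0 andbT.
apply: (@le0_of_natmul_le _ _ M) => n.
have := sqb_point v (fn n); rewrite ler_pdivlMr ?exprn_gt0//.
by apply: le_trans; rewrite ler_wpM2l ?sqr_ge0 ?natr_le_exp4.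
Qed.

Lemma cvg_sum (R : realType) (I : Type) (r : seq I) (F : nat -> I -> R) (L : I -> R) :
  (forall i, F n i @[n --> \oo] --> L i) ->
  \sum_(i <- r) F n i @[n --> \oo] --> \sum_(i <- r) L i.
Proof. by move=> FL; apply: (cvg_big add_continuous) => i _; exact: FL. Qed.

(* The solution is the Neumann series [- \sum_k l^(-k-1) A^k g], summed
   pointwise; the l^2 bound passes to the limit on finite sets of words. *)
Lemma neumann (R : realType) (w : word) (l : R) (g : word -> R) :
  100 <= `|l| -> l2 w g ->
  exists2 f, l2 w f & (fun v => adj f v - l * f v) = g.
Proof.
move=> l100 /l2P[g0 [M gM]]; have M0 := sqb_ge0 gM.
have l0 : l != 0 by rewrite -normr_gt0 (lt_le_trans _ l100).
pose d n : word -> R :=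
  iter n (fun f v => l^-1 * adj f v) (fun v => - l^-1 * g v).
pose S n v := \sum_(0 <= k < n) d k v.
(* The limit of this recursion in [n] is the equation to be solved. *)
have SS n v : S n.+1 v = l^-1 * adj (S n) v - l^-1 * g v.
  rewrite /S big_nat_recl// addrC -mulNr; congr (_ + _).
  rewrite /adj mulr_sumr /=; under eq_bigr => k _ do rewrite mulr_sumr.
  rewrite exchange_big; apply: eq_bigr => i _.
  by rewrite -mulr_sumr; congr (_ * _); rewrite -big_split.
have dM n : sqb (M / 4 ^+ n) (d n).
  elim: n => [|n IH]; last by rewrite exprSr invfM mulrA; exact: sqb_adj_div.
  move=> s us; have := sqbZ (- l^-1) gM us => /le_trans; apply.
  have l2 : 1 <= l ^+ 2 by rewrite -real_normK ?num_real//; nra.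
  by rewrite divr1 ler_piMl// sqrrN exprVn invf_le1// (lt_le_trans ltr01).
(* The bound reproduces itself along the recursion: [2 * (4 * M / 4) + 2 * M = 4 * M]. *)
have SM n : sqb (4 * M) (S n).
  elim: n => [|n IH] s us.
    by rewrite big1 ?mulr_ge0// => v _; rewrite /S big_geq// expr0n.
  have := sqbD (sqb_adj_div l100 IH) (@dM 0%N) us.
  under eq_bigr => v _ do rewrite /= mulNr -SS.
  by move/le_trans; apply; rewrite divr1; lra.
have cvgS v : cvgn (S ^~ v).
  apply: (@normed_cvg R _ (d ^~ v)).
  (* The terms satisfy [d n v ^+ 2 <= M / 4 ^+ n]; using [M <= (M + 1) ^+ 2] avoids a square root in
     the dominating series. *)
  apply: (@series_le_cvg _ _ (geometric (M + 1) 2^-1)).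
  - by move=> n; exact: normr_ge0.
  - by move=> n; rewrite /geometric /= mulr_ge0 ?exprn_ge0 ?addr_ge0// invr_ge0.
  - move=> n; rewrite /geometric /= -[leLHS]ger0_norm// -[leRHS]ger0_norm; last first.
      by rewrite mulr_ge0// ?exprn_ge0 ?addr_ge0.
    rewrite -ler_sqr ?nnegrE// !real_normK ?num_real// exprMn.
    apply: (le_trans (sqb_point v (dM n))).
    rewrite -exprM mulnC exprM (_ : 2^-1 ^+ 2 = 4^-1); last by field.
    by rewrite exprVn ler_pM2r ?invr_gt0 ?exprn_gt0//; nra.
  by apply: is_cvg_geometric_series; rewrite ger0_norm//; lra.
pose f v := limn (S ^~ v).
have Sf v : S n v @[n --> \oo] --> f v by exact: cvgS.
exists f.
  apply/l2P; split=> [v wv|].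
    have d0 n : forall u, ~ sorbit w u -> d n u = 0.
      elim: n => [|n IH] u wu; first by rewrite /d /= g0 ?mulr0.
      by rewrite /d /= (adj_eq0 IH) ?mulr0.
    rewrite /f (_ : S ^~ v = fun=> 0) ?lim_cst//.
    by apply/funext => n; rewrite /S big1// => k _; exact: d0.
  exists (4 * M) => s us.
  have /cvgr_to_le : \sum_(v <- s) S n v ^+ 2 @[n --> \oo] --> \sum_(v <- s) f v ^+ 2.
    apply: cvg_sum => v; rewrite expr2; under eq_fun do rewrite expr2.
    exact: cvgM.
  by apply; near=> n; exact: SM.
apply/funext => v.
have aS : adj (S n) v @[n --> \oo] --> adj f v.
  by apply: cvg_sum => i; exact: cvgD.
have SfS : S n.+1 v @[n --> \oo] --> f v by rewrite (cvg_shiftS (S ^~ v)).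
have : S n.+1 v @[n --> \oo] --> l^-1 * adj f v - l^-1 * g v.
  under eq_fun do rewrite SS.
  by apply: cvgB; [exact: cvgMr|exact: cvg_cst].
move=> /(cvg_unique _ SfS) -/(_ (@Rhausdorff R)) ->.
by rewrite mulrBr !mulVKf//; ring.
Unshelve. all: by end_near. Qed.

Lemma resolvent_large (R : realType) (w : word) (l : R) : 100 <= `|l| -> in_resolvent w l.
Proof.
move=> l100 g l2g; have [f l2f fE] := neumann l100 l2g.
exists f; split=> // f' [/l2P[_ f'M] f'E].
have /l2P[_ fM] := l2f.
apply/funext => v; apply/eqP; rewrite -subr_eq0 -mulN1r; apply/eqP.
apply: (adj_eigen_eq0 l100 (f := f \+ (fun v => -1 * f' v))) => [|u /=].
  by apply: sqfD => //; exact: sqfZ.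
have /(congr1 (fun h => h u)) := fE; have /(congr1 (fun h => h u)) := f'E.
move=> <- /eqP; rewrite subr_eq => /eqP afE.
have -> : adj (f \+ (fun v => -1 * f' v)) u = adj f u - adj f' u.
  by rewrite /adj -sumrB; apply: eq_bigr => i _ /=; ring.
by rewrite afE; ring.
Qed.

(** * Points of the spectrum *)

Lemma schur_linear (R : realType) (l a : R) (F G : word -> R) :
  schur l (fun v => a * F v + G v) = (fun v => a * schur l F v + schur l G v).
Proof.
apply/funext => v; rewrite /schur !big_ord_recr !big_ord0 /=; ring.
Qed.

Lemma e_after_nonzero (i : 'I_3) (v : word) (k m : nat) :
  v k != ord0 -> (k < m)%N -> e i v m = v m.
Proof.
move=> vk km; rewrite /e ifN//; apply/forallPn; exists (Ordinal km).
exact: vk.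
Qed.

(* A nonzero finitely supported functional annihilating the range of [adj - l];
   its support lies in words whose last difference with [w] is at position
   [n + 3], so that supports for distinct [n] are disjoint; a nonzero letter
   before that position keeps the generators from altering it. *)
Definition annihilator (R : realType) (w : word) (n : nat) (l : R)
    (Phi : (word -> R) -> R) (S : seq word) : Prop :=
  [/\ forall a F G, Phi (fun v => a * F v + G v) = a * Phi F + Phi G,
      forall F, {in S, forall v, F v = 0} -> Phi F = 0,
      forall v, v \in S -> [/\ v (n + 3)%N <> w (n + 3)%N,
        forall m, (n + 3 < m)%N -> v m = w m &
        exists2 k, (k <= n)%N & v k != ord0],
      exists F, Phi F <> 0 &
      forall F, Phi (fun v => adj F v - l * F v) = 0].

Lemma exists_annihilator (R : realType) (n : nat) (w : word) (l : R) :
  iter n (@renorm R) l = 4 -> (forall k, (k < n)%N -> iter k (@renorm R) l <> 4) ->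
  exists Phi S, annihilator w n l Phi S.
Proof.
elim: n w l => [|n IH] w l.
  move=> /= -> _.
  (* With [t] starting with the letters 3 and [x], the generator [e_1] fixes [t] and hence swaps
     [0t] and [1t]. The words [10t] and [11t] then have the same neighbours [00t] and [01t] apart
     from loops, so the difference of values at them kills the range of [adj - 4]. The letter [x]
     makes position 3 the last difference with [w]. *)
  have [x xw] : exists x, x <> w 3.
    case: (letterP (w 3)) => [->|[i ->]]; last by exists ord0.
    by exists (letter ord0).
  pose l1 := letter ord0; pose l2 := letter ord_max.
  pose t := wcons l2 (wcons x (wtail (wtail (wtail (wtail w))))).
  pose a := wcons l1 (wcons ord0 t); pose b := wcons l1 (wcons l1 t).
  exists (fun F => F a - F b), [:: a; b]; split.
  - by move=> c F G; ring.
  - by move=> F F0; rewrite !F0 ?subr0// !inE eqxx ?orbT.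
  - by move=> v; rewrite !inE => /orP[] /eqP ->;
      (split; [exact: xw|by move=> [|[|[|[|m]]]]|by exists 0%N]).
  - exists (fun v => (v == a)%:R); rewrite eqxx.
    case: eqP => [/(congr1 (fun v => v 1%N))//|_].
    by rewrite subr0; apply/eqP; rewrite oner_eq0.
  move=> F; rewrite !adj_wcons_letter.
  have -> : einv ord0 (wcons ord0 t) = wcons l1 t by rewrite einv_wcons.
  have -> : einv ord0 (wcons l1 t) = wcons ord0 t.
    by rewrite einv_wcons eqxx /t einv_wcons.
  by rewrite -/a -/b; ring.
rewrite iterSr => ln lk.
have l4 : l != 4 by apply/eqP; exact: (lk 0%N).
have l40 : l - 4 != 0 by rewrite subr_eq0.
have [k kn|Phi [S [PhiL PhiS SE [G G0] PhiA]]] := IH (wtail w) (renorm l) ln.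
  by rewrite -iterSr; exact: lk.
(* The functional for the tail is pulled back along the Schur complement; the list collects the
   words at which [schur l F v] reads [F]. *)
exists (fun F => Phi (schur l F)), (flatten [seq
  wcons ord0 v :: [seq wcons (letter i) (e i v) | i <- enum 'I_3]
    ++ [seq wcons (letter i) v | i <- enum 'I_3] | v <- S]); split.
- by move=> a F1 F2; rewrite schur_linear PhiL.
- move=> F F0; apply: PhiS => v vS.
  have F0' u : u \in wcons ord0 v :: [seq wcons (letter i) (e i v) | i <- enum 'I_3]
    ++ [seq wcons (letter i) v | i <- enum 'I_3] -> F u = 0.
    by move=> uv; apply: F0; apply/flattenP; eexists; [exact: map_f vS|].
  rewrite /schur F0' ?mem_head// mulr0 add0r big1// => i _.
  rewrite !F0' ?addr0// inE mem_cat; apply/orP; right; apply/orP.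
    by right; apply: (map_f (fun i => wcons (letter i) v)); rewrite mem_enum.
  by left; apply: (map_f (fun i => wcons (letter i) (e i v))); rewrite mem_enum.
- have cE v j : v (n + 3)%N <> wtail w (n + 3)%N ->
      (forall m, (n + 3 < m)%N -> v m = wtail w m) ->
      (exists2 k, (k <= n.+1)%N & wcons j v k != ord0) ->
      [/\ wcons j v (n.+1 + 3)%N <> w (n.+1 + 3)%N,
        forall m, (n.+1 + 3 < m)%N -> wcons j v m = w m &
        exists2 k, (k <= n.+1)%N & wcons j v k != ord0].
    by move=> v3 vm vk; split=> // -[|m]// nm; exact: vm.
  move=> u /flattenP[_ /mapP[v vS ->]].
  have [v3 vm [k kn vk]] := SE v vS.
  rewrite inE mem_cat => /orP[/eqP ->|/orP[] /mapP[i _ ->]].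
  + by apply: cE => //; exists k.+1.
  + have ev m : (n < m)%N -> e i v m = v m.
      by move=> nm; apply: (e_after_nonzero _ vk); exact: leq_ltn_trans nm.
    apply: cE; [|move=> m nm|by exists 0%N].
      by rewrite ev// -addn1 leq_add2l.
    by rewrite ev ?vm// (leq_ltn_trans _ nm)// leq_addr.
  + by apply: cE => //; exists 0%N.
(* Extending [G] by zero at nonzero first letters, scaled by [l - 4], gives a function whose Schur
   complement is [G]. *)
- exists (fun u => if u 0%N == ord0 then G (wtail u) / (l - 4) else 0).
  rewrite (_ : schur _ _ = G)//; apply/funext => v; rewrite /schur /=.
  by rewrite big1 ?addr0// mulrC mulfVK.
move=> F; rewrite (_ : schur _ _ = fun v => adj (fun u => F (wcons ord0 u)) v
  - renorm l * F (wcons ord0 v)); first exact: PhiA.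
by apply/funext => v; rewrite schurE.
Qed.

Lemma sum_le_subset (R : realType) (T : eqType) (r s : seq T) (F : T -> R) :
  uniq r -> uniq s -> (forall x, 0 <= F x) ->
  \sum_(x <- r | x \in s) F x <= \sum_(x <- s) F x.
Proof.
move=> ur us F0; rewrite [leRHS](bigID [in r])/= -[leLHS]addr0.
rewrite lerD ?sumr_ge0// -!(big_filter _ (fun x => x \in _)).
rewrite (perm_big [seq x <- s | x \in r])// uniq_perm ?filter_uniq// => x.
by rewrite !mem_filter andbC.
Qed.

(** A finitely supported functional is the pairing with the vector of its values on point masses;
    this vector is nonzero and can be normalised. *)
Lemma annihilator_kernel (R : realType) (w : word) (n : nat) (l : R)
    (Phi : (word -> R) -> R) (S : seq word) :
  annihilator w n l Phi S ->
  exists h (S' : seq word), [/\ uniq S', \sum_(v <- S') h v ^+ 2 = 1,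
    forall v, v \in S' -> v (n + 3)%N <> w (n + 3)%N /\
        forall m, (n + 3 < m)%N -> v m = w m &
    forall F, \sum_(v <- S') h v * (adj F v - l * F v) = 0].
Proof.
move=> [PhiL PhiS SE [G G0] PhiA].
pose delta (v : word) : word -> R := fun u => (u == v)%:R.
have Phi0 : Phi (fun=> 0) = 0 by apply: PhiS.
have PhiE F : Phi F = \sum_(v <- undup S) Phi (delta v) * F v.
  have sumL (r : seq word) : Phi (fun u => \sum_(v <- r) F v * delta v u) =
      \sum_(v <- r) F v * Phi (delta v).
    elim: r => [|v r IH].
      by under eq_fun do rewrite big_nil; rewrite big_nil.
    by under eq_fun do rewrite big_cons; rewrite big_cons PhiL IH.
  under eq_bigr do rewrite mulrC; rewrite -sumL.
  apply/eqP; rewrite -subr_eq0 addrC -mulN1r -PhiL; apply/eqP/PhiS => v vS.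
  rewrite mulN1r addrC (bigD1_seq v) ?mem_undup ?undup_uniq//= /delta eqxx mulr1.
  by rewrite big1 ?addr0 ?subrr// => u uv; rewrite eq_sym (negPf uv) mulr0.
pose N := \sum_(v <- undup S) Phi (delta v) ^+ 2.
have N0 : 0 < N.
  rewrite lt_neqAle sumr_ge0 ?andbT => [|v _]; last exact: sqr_ge0.
  apply: contra_notN G0 => /eqP N0; rewrite PhiE big_seq big1// => v vS.
  have : Phi (delta v) ^+ 2 <= 0.
    rewrite N0 /N (bigD1_seq v) ?undup_uniq//= lerDl sumr_ge0// => u _.
    exact: sqr_ge0.
  by rewrite le_eqVlt ltNge sqr_ge0 orbF sqrf_eq0 => /eqP ->; rewrite mul0r.
exists (fun v => Phi (delta v) / Num.sqrt N), (undup S); split.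
- exact: undup_uniq.
- under eq_bigr do rewrite expr_div_n sqr_sqrtr ?ltW//.
  by rewrite -mulr_suml divff// gt_eqF.
- by move=> v; rewrite mem_undup => /SE[].
move=> F; have := PhiA F; rewrite PhiE => E.
under eq_bigr do rewrite mulrAC.
by rewrite -mulr_suml E mul0r.
Qed.

Lemma sorbit_support (n : nat) (w v : word) :
  (forall m, (n + 3 < m)%N -> v m = w m) -> sorbit w v.
Proof. by move=> vw; apply: (@sorbit_cofinal (n + 3).+1). Qed.

(** A point mass at a word where the annihilating vector [h] is nonzero lies outside the range, as
    its pairing with [h] does not vanish. *)
Lemma spectrum_preimage (R : realType) (n : nat) (w : word) (l : R) :
  iter n (@renorm R) l = 4 -> (forall k, (k < n)%N -> iter k (@renorm R) l <> 4) ->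
  in_spectrum w l.
Proof.
move=> ln lk; have [Phi [S /annihilator_kernel]] := exists_annihilator w ln lk.
move=> [h [S' [uS h1 SE hA]]].
have [v vS hv] : exists2 v, v \in S' & h v != 0.
  apply/hasP; rewrite -[has _ _]negbK -all_predC; apply/allP => h0.
  have : (1 : R) = 0; last by move/eqP; rewrite oner_eq0.
  rewrite -h1 big_seq big1// => v /h0 /=; rewrite negbK => /eqP ->.
  by rewrite expr0n.
pose g (u : word) : R := (u == v)%:R.
move=> /(_ g)[|f [[_ fE] _]].
  apply/l2P; split.
    move=> u; rewrite /g; case: eqP => // -> [].
    by have [_ vm] := SE v vS; exact: (sorbit_support vm).
  exists 1 => s us; apply: (@le_trans _ _ (\sum_(u <- s | u \in [:: v]) 1)).
    rewrite [leRHS]big_mkcond; apply: ler_sum => u _; rewrite /g inE.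
    by case: eqP; rewrite ?expr1n ?expr0n.
  by apply: (le_trans (sum_le_subset us _ _)); rewrite ?big_seq1.
have := hA f; under eq_bigr => u _ do rewrite [X in _ * X](congr1 (@^~ u) fE).
rewrite (bigD1_seq v)//= /g eqxx mulr1 big1 ?addr0 => [/eqP|u uv].
  by rewrite (negPf hv).
by rewrite (negPf uv) mulr0.
Qed.

Lemma cauchy_schwarz_unit (R : realType) (T : Type) (s : seq T) (h f : T -> R) :
  \sum_(v <- s) h v ^+ 2 = 1 ->
  (\sum_(v <- s) h v * f v) ^+ 2 <= \sum_(v <- s) f v ^+ 2.
Proof.
move=> h1; set t := \sum_(v <- s) h v * f v.
have : 0 <= \sum_(v <- s) (f v - t * h v) ^+ 2.
  by apply: sumr_ge0 => v _; exact: sqr_ge0.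
have -> : \sum_(v <- s) (f v - t * h v) ^+ 2 =
    \sum_(v <- s) f v ^+ 2 - 2 * t * t + t ^+ 2 * \sum_(v <- s) h v ^+ 2.
  have -> : 2 * t * t = \sum_(v <- s) 2 * t * (h v * f v) by rewrite -mulr_sumr.
  rewrite mulr_sumr -sumrB -big_split; apply: eq_bigr => v _ /=.
  by ring.
rewrite h1.
by move=> ?; lra.
Qed.

Lemma sum_geometric4_le2 (R : realType) (n : nat) :
  \sum_(k < n) (4 ^+ k)^-1 <= 2 :> R.
Proof.
have : \sum_(k < n) (4 ^+ k)^-1 <= 2 - 2 * (4 ^+ n)^-1 :> R.
  elim: n => [|n IH]; first by rewrite big_ord0 expr0 invr1; lra.
  rewrite big_ord_recr /= exprS invfM.
  have : 0 < (4 ^+ n)^-1 :> R by rewrite invr_gt0 exprn_gt0.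
  by move=> ?; lra.
have : 0 < (4 ^+ n)^-1 :> R by rewrite invr_gt0 exprn_gt0.
by move=> ? ?; lra.
Qed.

(* Gliding hump: with [h n] the unit vectors of the annihilators, the function
   [\sum_n 2^-n h n] is square summable but not in the range of [adj - l]. *)
Lemma spectrum_limit (R : realType) (w : word) (l : R) (mu : nat -> R) :
  (forall n, iter n (@renorm R) (mu n) = 4) ->
  (forall n k, (k < n)%N -> iter k (@renorm R) (mu n) <> 4) ->
  (forall n, `|l - mu n| <= 8 / 4 ^+ n) ->
  in_spectrum w l.
Proof.
move=> mun muk lmu.
have /choice[h /choice[S hS]] : forall n, exists h (S' : seq word),
    [/\ uniq S', \sum_(v <- S') h v ^+ 2 = 1,
    forall v, v \in S' -> v (n + 3)%N <> w (n + 3)%N /\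
        forall m, (n + 3 < m)%N -> v m = w m &
    forall F, \sum_(v <- S') h v * (adj F v - mu n * F v) = 0].
  move=> n; have [Phi [S]] := exists_annihilator w (mun n) (muk n).
  exact: annihilator_kernel.
have Sdisj n m v : v \in S n -> v \in S m -> n = m.
  wlog nm : n m / (n < m)%N => [wl vn vm|vn vm].
    have [nm|mn|//] := ltngtP n m; first exact: wl.
    by apply/esym; exact: wl.
  have [_ _ /(_ v vn)[_ vw] _] := hS n; have [_ _ /(_ v vm)[+ _] _] := hS m.
  by rewrite vw// ltn_add2r.
(* The index of the hump containing [v]. The default 0 is harmless because [g] tests membership in
   [S (k v)] again. *)
pose k v := xget 0%N [set n | v \in S n].
have kE n v : v \in S n -> k v = n.
  move=> vn; rewrite /k; case: xgetP => [m _ vm|/(_ n)//]; exact: Sdisj vm vn.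
pose g v : R := if v \in S (k v) then 2^-1 ^+ (k v) * h (k v) v else 0.
have gE n v : v \in S n -> g v = 2^-1 ^+ n * h n v.
  by move=> vn; rewrite /g (kE _ _ vn) vn.
move=> /(_ g)[|f [[/l2P[_ [M fM]] fE] _]].
  apply/l2P; split.
    move=> v; rewrite /g; case: ifP => // vn [].
    by have [_ _ /(_ v vn)[_ /sorbit_support]] := hS (k v).
  exists 2 => s us; pose B := (\max_(v <- s) k v).+1.
  pose G n v := if v \in S n then (4 ^+ n)^-1 * h n v ^+ 2 else 0.
  have G0 n v : 0 <= G n v.
    by rewrite /G; case: ifP => // _; rewrite mulr_ge0 ?sqr_ge0// invr_ge0 exprn_ge0.
  apply: (@le_trans _ _ (\sum_(v <- s) \sum_(n < B) G n v)).
    rewrite big_seq [leRHS]big_seq; apply: ler_sum => v vs.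
    have kB : (k v < B)%N by rewrite ltnS; exact: leq_bigmax_seq.
    rewrite (bigD1 (Ordinal kB))//= -[leLHS]addr0 lerD ?sumr_ge0//.
    rewrite /g /G; case: ifP => _; last by rewrite expr0n.
    by rewrite exprMn -exprM mulnC exprM -exprVn expr2 -invfM -natrM.
  rewrite exchange_big /=; apply: le_trans (@sum_geometric4_le2 _ B).
  apply: ler_sum => n _; have [uS h1 _ _] := hS n.
  rewrite -big_mkcond -mulr_sumr ler_piMr ?invr_ge0 ?exprn_ge0// -h1.
  by apply: sum_le_subset => // v; exact: sqr_ge0.
(* Pairing a solution [f] with [h n] gives [2^-n = (mu n - l) * t] with [t^2 <= M]. Squaring yields
   [4^-n <= 64 * 16^-n * M], so [4^n <= 64 * M] for all [n]. *)
have : (1 : R) <= 0; last by rewrite ler10.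
apply: (@le0_of_natmul_le _ _ (64 * M)) => n; rewrite mul1r.
apply: le_trans (@natr_le_exp4 _ n) _.
have [uS h1 _ hA] := hS n.
have gn : \sum_(v <- S n) h n v * g v = 2^-1 ^+ n.
  rewrite -[RHS]mulr1 -[X in _ = _ * X]h1 mulr_sumr big_seq [RHS]big_seq.
  by apply: eq_bigr => v /gE ->; rewrite mulrCA -expr2.
have gf : \sum_(v <- S n) h n v * g v = (mu n - l) * \sum_(v <- S n) h n v * f v.
  rewrite -[LHS]subr0 -[X in _ - X = _](hA f) -sumrB mulr_sumr; apply: eq_bigr => v _.
  by rewrite -fE; ring.
have := cauchy_schwarz_unit f h1; rewrite gn in gf.
move: gf; set t := \sum_(v <- S n) h n v * f v => gt tM.
have {}tM : t ^+ 2 <= M by apply: (le_trans tM); exact: fM.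
have M0 := sqb_ge0 fM.
have E : (4 ^+ n)^-1 = (mu n - l) ^+ 2 * t ^+ 2 :> R.
  rewrite -exprMn -gt -exprM mulnC exprM expr2 -invfM -natrM exprVn //.
have d2 : (mu n - l) ^+ 2 <= 64 * ((4 ^+ n)^-1 * (4 ^+ n)^-1).
  rewrite -real_normK ?num_real// distrC.
  apply: (@le_trans _ _ ((8 / 4 ^+ n) ^+ 2)).
    by rewrite ler_sqr ?nnegrE// mulr_ge0// invr_ge0 exprn_ge0.
  by rewrite expr2 mulrACA -natrM.
have q0 : 0 < (4 ^+ n)^-1 :> R by rewrite invr_gt0 exprn_gt0.
rewrite -[4 ^+ n]invrK; move: E d2 q0; set q := (4 ^+ n)^-1 => E d2 q0.
rewrite -[q^-1]mul1r ler_pdivrMr// -(ler_pM2l q0) mulr1 {1}E.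
have := sqr_ge0 t; have := sqr_ge0 (mu n - l) => d0 t0.
apply: (le_trans (ler_pM d0 t0 d2 tM)).
by rewrite le_eqVlt; apply/orP; left; apply/eqP; ring.
Qed.

(** * Dynamics of the renormalization map *)

(** The points of bounded orbit: 4 is the repelling fixed point of [x^2 - 12] in the coordinate
    [x = l - 2], and orbits leaving [[-4, 4]] escape. *)
Definition julia (R : realType) : set R :=
  [set l | forall n, `|iter n (@renorm R) l - 2| <= 4].

Lemma renormB2 (R : realType) (l : R) : renorm l - 2 = (l - 2) ^+ 2 - 12.
Proof. by rewrite /renorm; ring. Qed.

(** The factor 8 is the derivative of [x^2 - 12] at its fixed point 4; the parabola lies above that
    tangent. *)
Lemma renorm_growth (R : realType) (l : R) : 4 < `|l - 2| ->
  8 * (`|l - 2| - 4) <= `|renorm l - 2| - 4.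
Proof.
move=> l4; rewrite renormB2 -real_normK ?num_real//.
by rewrite [X in _ <= X - _]ger0_norm; have := sqr_ge0 (`|l - 2| - 4); nra.
Qed.

Lemma iter_renorm_growth (R : realType) (n : nat) (l : R) : 4 < `|l - 2| ->
  8 ^+ n * (`|l - 2| - 4) <= `|iter n (@renorm R) l - 2| - 4.
Proof.
elim: n l => [|n IH] l l4; first by rewrite expr0 mul1r.
have h := renorm_growth l4; have l4' : 4 < `|renorm l - 2| by lra.
rewrite iterSr; apply: le_trans (IH _ l4').
by rewrite exprSr -mulrA ler_pM2l ?exprn_gt0.
Qed.

Lemma iter_renorm_escape (R : realType) (n : nat) (l : R) : 4 < `|l - 2| ->
  4 < `|iter n (@renorm R) l - 2|.
Proof.
move=> l4; have := iter_renorm_growth n l4.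
have : 0 < 8 ^+ n * (`|l - 2| - 4) by rewrite mulr_gt0 ?exprn_gt0 ?subr_gt0.
by move=> ? ?; lra.
Qed.

Lemma iter_renorm_large (R : realType) (l : R) : 4 < `|l - 2| ->
  exists n, 100 <= `|iter n (@renorm R) l|.
Proof.
move=> l4; apply/not_existsP => small.
have : `|l - 2| - 4 <= 0; last by move=> ?; lra.
apply: (@le0_of_natmul_le _ _ 200) => n.
have := iter_renorm_growth n l4.
have /negP := small n; rewrite -ltNge => s.
have n8 : n%:R <= 8 ^+ n :> R by rewrite -natrX ler_nat ltnW// ltn_expl.
have h : (`|l - 2| - 4) * n%:R <= 8 ^+ n * (`|l - 2| - 4).
  by rewrite mulrC ler_wpM2r//; lra.
have : `|iter n (@renorm R) l - 2| <= `|iter n (@renorm R) l| + 2.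
  by rewrite (le_trans (ler_normB _ _))// lerD2l ger0_norm.
by move=> ? ?; lra.
Qed.

(** In the coordinate [x = l - 2] the first step takes 2 to -8, which escapes. Hence an orbit meets
    4 at most once and the levels of preimages are disjoint. *)
Lemma iter_renorm4 (R : realType) (n : nat) :
  (0 < n)%N -> 4 < `|iter n (@renorm R) 4 - 2|.
Proof.
case: n => // n _; rewrite iterSr; apply: iter_renorm_escape.
rewrite renormB2 ler0_norm /=; last by rewrite expr2; lra.
by rewrite expr2; lra.
Qed.

Lemma iter_renorm_inj4 (R : realType) (n m : nat) (l : R) :
  iter n (@renorm R) l = 4 -> iter m (@renorm R) l = 4 -> n = m.
Proof.
wlog nm : n m / (n < m)%N => [wl ln lm|ln lm].
  have [nm|mn|//] := ltngtP n m; first exact: wl.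
  by apply/esym; exact: wl.
have : 4 < `|iter (m - n) (@renorm R) 4 - 2| by rewrite iter_renorm4// subn_gt0.
rewrite -[X in iter _ _ X]ln -iterD subnK 1?ltnW// lm ger0_norm; last by lra.
by move=> ?; exfalso; lra.
Qed.

Lemma iter_renorm_neq4 (R : realType) (n k : nat) (l : R) :
  iter n (@renorm R) l = 4 -> (k < n)%N -> iter k (@renorm R) l <> 4.
Proof.
by move=> ln kn /(iter_renorm_inj4 ln) nk; move: kn; rewrite nk ltnn.
Qed.

Lemma resolvent_iter (R : realType) (n : nat) (w : word) (l : R) :
  (forall k, (k < n)%N -> iter k (@renorm R) l <> 4) ->
  in_resolvent (iter n wtail w) (iter n (@renorm R) l) -> in_resolvent w l.
Proof.
elim: n w l => [//|n IH] w l lk; rewrite !iterSr => lr.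
apply: resolvent_wtail; first by apply/eqP; exact: (lk 0%N).
by apply: IH lr => k kn; rewrite -iterSr; exact: lk.
Qed.

(** The roots of [renorm x = l], that is of [(x - 2)^2 = 10 + l]. As [Num.sqrt] is 0 on negative
    numbers, the bound that keeps [10 + l] positive accompanies these lists. *)
Definition preimages (R : realType) (s : seq R) : seq R :=
  flatten [seq [:: 2 + Num.sqrt (10 + l); 2 - Num.sqrt (10 + l)] | l <- s].

Lemma preimages_cons (R : realType) (l : R) (s : seq R) : preimages (l :: s) =
  [:: 2 + Num.sqrt (10 + l), 2 - Num.sqrt (10 + l) & preimages s].
Proof. by []. Qed.

(** The innermost 14 is [10 + 4], and each further radicand is [10 + (2 + q)] or [10 + (2 - q)]. *)
Lemma Rn_iter (R : realType) (n : nat) :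
  Rn n.+1 = iter n.+1 (@preimages R) [:: 4].
Proof.
elim: n => [|n IH].
  by rewrite /Rn /preimages /= (_ : 10 + 4 = 14 :> R)//; lra.
rewrite iterS -IH /Rn [@Q R n.+2]/= -/(@Q R n.+1); elim: (@Q R n.+1) => //= q s IHs.
rewrite /Qstep /= !preimages_cons. have -> : 10 + (2 + q) = 12 + q by ring.
have -> : 10 + (2 - q) = 12 - q by ring.
by congr [:: _, _, _, _ & _].
Qed.

Lemma preimages_bound (R : realType) (s : seq R) :
  {in s, forall l, `|l - 2| <= 4} -> {in preimages s, forall x, `|x - 2| <= 4}.
Proof.
move=> sb x /flattenP[_ /mapP[l /sb ls ->]].
have l0 : 0 <= 10 + l by move: ls; rewrite ler_norml; lra.
have a4 : Num.sqrt (10 + l) <= 4.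
  rewrite -(@ger0_norm _ 4)// -sqrtr_sqr ler_wsqrtr//.
  by move: ls; rewrite ler_norml expr2; lra.
have := sqrtr_ge0 (10 + l).
by rewrite !inE => a0 /orP[] /eqP ->; rewrite ler_norml; lra.
Qed.

Lemma mem_preimages (R : realType) (s : seq R) (x : R) :
  {in s, forall l, `|l - 2| <= 4} -> (x \in preimages s) = (renorm x \in s).
Proof.
move=> sb; apply/idP/idP => [/flattenP[_ /mapP[l ls ->]]|xs].
  have l0 : 0 <= 10 + l by have := sb l ls; rewrite ler_norml; lra.
  have aE (a : R) : a ^+ 2 = 10 + l -> renorm (2 + a) = l.
    by move=> a2; rewrite -[RHS](addrK 10) [l + 10]addrC -a2 /renorm; ring.
  by rewrite !inE => /orP[] /eqP ->; rewrite aE// ?sqrrN sqr_sqrtr.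
apply/flattenP; eexists; first exact: map_f xs.
have -> : 10 + renorm x = (x - 2) ^+ 2 by rewrite /renorm; ring.
rewrite sqrtr_sqr !inE; have [_|_] := ger0P (x - 2); apply/orP; [left|right];
  by apply/eqP; ring.
Qed.

Lemma iter_preimages_bound (R : realType) (n : nat) (s : seq R) :
  {in s, forall l, `|l - 2| <= 4} ->
  {in iter n (@preimages R) s, forall x, `|x - 2| <= 4}.
Proof. by move=> sb; elim: n => // n IH; exact: preimages_bound. Qed.

Lemma mem_iter_preimages (R : realType) (n : nat) (s : seq R) (x : R) :
  {in s, forall l, `|l - 2| <= 4} ->
  (x \in iter n (@preimages R) s) = (iter n (@renorm R) x \in s).
Proof.
move=> sb; elim: n x => // n IH x.
by rewrite iterS mem_preimages ?IH ?iterSr//; exact: iter_preimages_bound.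
Qed.

Lemma bound4 (R : realType) : {in [:: 4 : R], forall l, `|l - 2| <= 4}.
Proof. by move=> l; rewrite inE => /eqP ->; rewrite ler_norml; lra. Qed.

Lemma mem_Rn (R : realType) (n : nat) (x : R) :
  (x \in Rn n.+1) = (iter n.+1 (@renorm R) x == 4).
Proof. by rewrite Rn_iter mem_iter_preimages ?inE//; exact: bound4. Qed.

Lemma RsetP (R : realType) (x : R) :
  Rset x <-> exists n, iter n (@renorm R) x = 4.
Proof.
split=> [[->|[[|n]// _]]|[[|n]]].
- by exists 0%N.
- by rewrite mem_Rn => /eqP; exists n.+1.
- by left.
- by move=> /eqP xn; right; exists n.+1 => //; rewrite mem_Rn.
Qed.

Lemma uniq_preimages (R : realType) (s : seq R) :
  {in s, forall l, `|l - 2| <= 4} -> uniq s -> uniq (preimages s).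
Proof.
elim: s => // l s IH sb; rewrite cons_uniq => /andP[ls us].
have sb' : {in s, forall l, `|l - 2| <= 4}.
  by move=> x xs; apply: sb; rewrite inE xs orbT.
have lb : `|l - 2| <= 4 by apply: sb; rewrite mem_head.
have a0 : 0 < Num.sqrt (10 + l).
  by rewrite sqrtr_gt0; move: lb; rewrite ler_norml; lra.
have lE x : x \in preimages [:: l] -> renorm x = l.
  rewrite mem_preimages => [|y]; rewrite inE => /eqP -> //.
rewrite preimages_cons /= IH// inE negb_or !mem_preimages// !lE ?ls ?andbT//.
- by apply/eqP => ?; lra.
- by rewrite !inE eqxx orbT.
- by rewrite !inE eqxx.
Qed.

Lemma uniq_Rn (R : realType) (n : nat) : uniq (@Rn R n).
Proof.
case: n => // n; rewrite Rn_iter; elim: n.+1 => // m IH.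
by apply: uniq_preimages => //; apply: iter_preimages_bound; exact: bound4.
Qed.

Lemma size_iter_preimages (R : realType) (n : nat) (s : seq R) :
  size (iter n (@preimages R) s) = (2 ^ n * size s)%N.
Proof.
elim: n => [|n IH]; first by rewrite mul1n.
rewrite iterS expnS -mulnA -IH; elim: (iter n _ s) => //= l t IHt.
by rewrite IHt; lia.
Qed.

(* The inverse branches of [renorm] contract by a factor at least [4] on
   [|l - 2| >= sqrt 8]. *)
Lemma iter_preimage_approx (R : realType) (n : nat) (x z : R) :
  julia x -> `|z - 2| <= 4 ->
  exists y, [/\ iter n (@renorm R) y = z,
    forall k, (k <= n)%N -> `|iter k (@renorm R) y - 2| <= 4 &
    `|x - y| <= 8 / 4 ^+ n].
Proof.
move=> + z4; elim: n x => [|n IH] x xJ.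
  exists z; split=> //; first by case.
  by have := xJ 0%N; move: z4; rewrite /= divr1 !ler_norml; lra.
have [|y [yz yk xy]] := IH (renorm x).
  by move=> k; rewrite -iterSr; exact: xJ.
have y4 : `|y - 2| <= 4 := yk 0%N isT.
have rx : `|renorm x - 2| <= 4 := xJ 1%N.
have x2 : 8 <= (x - 2) ^+ 2 by move: rx; rewrite renormB2 ler_norml; lra.
pose b := Num.sqrt (10 + y).
have b2 : b ^+ 2 = 10 + y.
  by rewrite sqr_sqrtr//; move: y4; rewrite ler_norml; lra.
have b0 : 0 <= b := sqrtr_ge0 _.
have b2l : 2 <= b by move: y4; rewrite ler_norml; nra.
(* The branch on the same side of 2 as [x] is taken, so that [x - 2] and [y' - 2] add up without
   cancellation in [x + y' - 4], the factor relating [x - y'] to [renorm x - y]. *)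
pose y' := if 2 <= x then 2 + b else 2 - b.
have y'2 : (y' - 2) ^+ 2 = 10 + y.
  by rewrite -b2 /y'; case: ifP => _; ring.
have ry' : renorm y' = y.
  by rewrite -[LHS](subrK 2) renormB2 y'2; ring.
have yj k : (k <= n.+1)%N -> `|iter k (@renorm R) y' - 2| <= 4.
  case: k => [_|k]; last by rewrite iterSr ry'; exact: yk.
  have b4 : b <= 4 by move: y4; rewrite ler_norml; nra.
  by rewrite /y' /= ler_norml; case: ifP => _; lra.
exists y'; split=> //; first by rewrite iterSr ry'.
have xyE : renorm x - y = (x - y') * (x + y' - 4).
  by rewrite -ry' /renorm; ring.
have s4 : 4 <= `|x + y' - 4|.
  rewrite /y'; case: ifPn => [x2'|]; last rewrite -ltNge => x2'.
    by rewrite ger0_norm; nra.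
  by rewrite ler0_norm; nra.
rewrite exprS invfM mulrCA ler_pdivlMl//.
apply: le_trans xy; rewrite xyE normrM mulrC ler_wpM2l//.
Qed.

(** * The Julia set and the spectrum *)

Lemma continuous_iter_renorm (R : realType) (n : nat) :
  continuous (iter n (@renorm R)).
Proof.
elim: n => [|n IH] x; first exact: cvg_id.
rewrite (_ : iter n.+1 _ = fun y => iter n (@renorm R) y * iter n (@renorm R) y
    - 4 * iter n (@renorm R) y - 6); last first.
  by apply/funext => y; rewrite iterS /renorm expr2.
apply: cvgB; last exact: cvg_cst.
by apply: cvgB; [apply: cvgM|apply: cvgMr]; exact: IH.
Qed.

Lemma open_escape (R : realType) (n : nat) :
  open [set x : R | 4 < `|iter n (@renorm R) x - 2|].
Proof.
rewrite (_ : [set x | _] = (fun x => `|iter n (@renorm R) x - 2|) @^-1` [set y | 4 < y])//.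
apply: open_comp; last exact: open_gt.
move=> x _; apply: cvg_norm.
by apply: cvgB; [exact: continuous_iter_renorm|exact: cvg_cst].
Qed.

Lemma julia_escape (R : realType) (x : R) : ~ julia x ->
  exists n, 4 < `|iter n (@renorm R) x - 2|.
Proof.
by move=> /existsNP[n /negP]; rewrite -ltNge; exists n.
Qed.

Lemma closed_julia (R : realType) : closed (@julia R).
Proof.
rewrite -openC openE => x /= /julia_escape[n xn].
apply: (filterS _ (open_nbhs_nbhs (conj (@open_escape R n) xn))).
by move=> y /= yn /(_ n); rewrite leNgt yn.
Qed.

Lemma julia_bound (R : realType) (x : R) : julia x -> -2 <= x <= 6.
Proof. by move=> /(_ 0%N); rewrite /= ler_norml => /andP[? ?]; lra. Qed.

Lemma compact_julia (R : realType) : compact (@julia R).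
Proof.
apply: (subclosed_compact (@closed_julia R) (@segment_compact R (-2) 6)).
by move=> x /julia_bound; rewrite /= in_itv.
Qed.

Lemma iter_fixed (T : Type) (f : T -> T) (x : T) (n : nat) :
  f x = x -> iter n f x = x.
Proof. by move=> fx; elim: n => //= n ->. Qed.

Lemma renorm6 (R : realType) : renorm 6 = 6 :> R.
Proof. by rewrite /renorm; ring. Qed.

Lemma julia6 (R : realType) : julia (6 : R).
Proof.
move=> n; rewrite iter_fixed; last exact: renorm6.
by rewrite ler_norml; lra.
Qed.

Lemma juliaN2 (R : realType) : julia (-2 : R).
Proof.
move=> [|n]; first by rewrite /= ler_norml; lra.
by rewrite iterSr (_ : renorm (-2) = 6) ?(julia6 R n)// /renorm; ring.
Qed.

Lemma julia_iter (R : realType) (n : nat) (y : R) :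
  (forall k, (k <= n)%N -> `|iter k (@renorm R) y - 2| <= 4) ->
  julia (iter n (@renorm R) y) -> julia y.
Proof.
move=> yk yn m; have [mn|nm] := leqP m n; first exact: yk.
by have := yn (m - n)%N; rewrite -iterD subnK// ltnW.
Qed.

Lemma julia_symmetric (R : realType) (x : R) : julia x -> julia (4 - x).
Proof.
move=> xJ [|n].
  have := xJ 0%N; rewrite /= (_ : 4 - x - 2 = - (x - 2)) ?normrN//.
  by ring.
have := xJ n.+1; rewrite !iterSr (_ : renorm (4 - x) = renorm x)//.
by rewrite /renorm; ring.
Qed.

Lemma exists_div_exp4_lt (R : realType) (c e : R) : 0 < e ->
  exists n, c / 4 ^+ n < e.
Proof.
move=> e0; apply/not_existsP => h; have : e <= 0; last by rewrite leNgt e0.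
apply: (@le0_of_natmul_le _ _ c) => n.
apply: (@le_trans _ _ (e * 4 ^+ n)); first by rewrite ler_wpM2l ?natr_le_exp4 ?ltW.
by rewrite -ler_pdivlMr ?exprn_gt0// leNgt; apply/negP; exact: h.
Qed.

Lemma perfect_julia (R : realType) : perfect_set (@julia R).
Proof.
split; first exact: closed_julia.
apply/seteqP; split=> [x /subset_limit_point|x xJ U]; first exact: closed_julia.
rewrite -nbhs_ballE => -[e /= e0 eU].
have [n ne] := exists_div_exp4_lt 8 e0.
(* A Julia point other than the [n]-th iterate of [x] pulls back to a Julia point close to [x] and
   different from it. *)
have [z zJ zx] : exists2 z, julia z & z != iter n (@renorm R) x.
  have [x6|x6] := eqVneq (iter n (@renorm R) x) 6.
    by exists (-2); [exact: juliaN2|rewrite x6; apply/eqP => ?; lra].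
  by exists 6; [exact: julia6|rewrite eq_sym].
have [y [yz yk xy]] := iter_preimage_approx n xJ (zJ 0%N).
exists y; split; first by apply: contraNneq zx => <-; rewrite yz.
  by apply: (julia_iter yk); rewrite yz.
by apply: eU; rewrite /ball /= (le_lt_trans xy).
Qed.

(** The [2^n] preimages of 4 at level [n] are centres of intervals of length [16 / 4^n] covering the
    set, of total length [16 / 2^n]. *)
Lemma lebesgue_julia (R : realType) : lebesgue_measure (@julia R) = 0%E.
Proof.
have mJ : measurable (@julia R) by apply: measurable_realfun.closed_measurable; exact: closed_julia.
have h n : (lebesgue_measure (@julia R) <= (16 / 2 ^+ n)%:E)%E.
  pose r := iter n (@preimages R) [:: 4].
  have := @content_sub_fsum _ _ _ (@lebesgue_measure R) R [set` r] (@julia R)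
    (fun y => `[y - 8 / 4 ^+ n, y + 8 / 4 ^+ n]%classic).
  move/(_ (finite_seq _)) => /(_ (fun _ _ => measurable_itv _) mJ).
  move=> /(_ _)/le_trans; apply.
    move=> x xJ; have [y [yz _ xy]] := iter_preimage_approx n xJ (bound4 (mem_head _ _)).
    exists y; first by rewrite /= /r mem_iter_preimages ?yz ?mem_head//; exact: bound4.
    by move: xy; rewrite /= in_itv /= ler_norml; lra.
  rewrite -fsbig_seq; last first.
    rewrite /r; elim: n {r} => // m IH.
    by apply: uniq_preimages => //; apply: iter_preimages_bound; exact: bound4.
  rewrite (eq_bigr (fun=> (16 / 4 ^+ n)%:E)) => [|y _]; last first.
    rewrite -[LHS]/(lebesgue_measure
      (`[y - 8 / 4 ^+ n, y + 8 / 4 ^+ n]%classic : set R)).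
    rewrite lebesgue_measure_itv /= lte_fin.
    have q0 : 0 < 8 / 4 ^+ n :> R by rewrite divr_gt0// exprn_gt0.
    rewrite ifT; last by lra.
    rewrite -EFinD; congr (_%:E); lra.
  rewrite sumEFin lee_fin big_const_seq count_predT size_iter_preimages muln1.
  rewrite iter_addr_0 -[leLHS]mulr_natr natrX le_eqVlt; apply/orP; left; apply/eqP.
  rewrite (_ : 4 = 2 * 2 :> R); last by ring.
  by rewrite exprMn invfM -!mulrA mulVf ?mulr1// expf_neq0.
apply/eqP; rewrite eq_le measure_ge0 andbT.
apply/lee_addgt0Pr => e e0; rewrite add0e.
have [n ne] := exists_div_exp4_lt 16 e0.
apply: le_trans (h (2 * n)%N) _; rewrite lee_fin exprM.
by rewrite (_ : 2 ^+ 2 = 4) ?ltW//; ring.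
Qed.

(** A component with two points would contain an interval, contradicting measure zero. *)
Lemma totally_disconnected_julia (R : realType) : totally_disconnected (@julia R).
Proof.
move=> x xJ; apply/seteqP; split=> [y xy|_ ->]; last first.
  exact: connected_component_refl.
have cI : connected (connected_component (@julia R) x) by exact: component_connected.
have CJ := @connected_component_sub _ (@julia R) x.
have cx := connected_component_refl xJ.
apply/eqP; apply: contraT => yx; exfalso.
have {}yx : y != x by [].
suff [a [b [ab abJ]]] : exists a b : R, a < b /\ `[a, b] `<=` @julia R.
  have : (lebesgue_measure (`[a, b]%classic : set R) <= lebesgue_measure (@julia R))%E.
    apply: le_measure => //; rewrite inE; first exact: measurable_itv.
    by apply: measurable_realfun.closed_measurable; exact: closed_julia.
  rewrite lebesgue_julia lebesgue_measure_itv /= lte_fin ab -EFinB lee_fin.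
  by move=> ?; lra.
move/connected_intervalP : cI => cI.
by case: (ltgtP x y) yx => // [lt|lt] _; [exists x, y|exists y, x]; split=> // z;
  rewrite /= in_itv => /= zab; apply: CJ; apply: cI zab.
Qed.

Lemma cantor_julia (R : realType) : cantor_set (@julia R).
Proof.
split; [by exists 6; exact: julia6|exact: compact_julia|exact: perfect_julia|].
exact: totally_disconnected_julia.
Qed.

Lemma finite_preimages_below (R : realType) (n : nat) :
  finite_set [set x : R | exists2 k, (k < n)%N & iter k (@renorm R) x = 4].
Proof.
rewrite (_ : [set x | _] = \bigcup_(k in `I_n) [set` iter k (@preimages R) [:: 4]]).
  by apply: bigcup_finite => // k _; exact: finite_seq.
apply/seteqP; split=> x [k kn] /= xk; exists k => //=.
  by rewrite mem_iter_preimages ?inE ?xk//; exact: bound4.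
by move: xk; rewrite mem_iter_preimages ?inE => [/eqP//|]; exact: bound4.
Qed.

(** Near a point escaping by time [n] all points have escaped by then and cannot reach 4 from time
    [n] on, so only the finitely many preimages of lower level have to be avoided. *)
Lemma closed_julia_Rset (R : realType) : closed (@julia R `|` @Rset R).
Proof.
rewrite -openC openE => x /= /not_orP[/julia_escape[n xn] xR].
pose U := [set x : R | 4 < `|iter n (@renorm R) x - 2|] `&`
  ~` [set x : R | exists2 k, (k < n)%N & iter k (@renorm R) x = 4].
have : open_nbhs x U.
  split; last by split=> // -[k _ xk]; apply: xR; apply/RsetP; exists k.
  apply: openI; first exact: open_escape.
  rewrite openC; apply: (iffLR accessible_finite_set_closed).
    exact/hausdorff_accessible/Rhausdorff.
  exact: finite_preimages_below.
move/open_nbhs_nbhs; apply: filterS => y [/= yn yk].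
move=> [/(_ n)|/RsetP[m ym]]; first by rewrite leNgt yn.
have [mn|nm] := ltnP m n; first by apply: yk; exists m.
have := iter_renorm_escape (m - n) yn.
by rewrite -iterD subnK// ym ger0_norm; [move=> ?; lra|lra].
Qed.

Lemma closure_Rset (R : realType) : closure (@Rset R) = @julia R `|` @Rset R.
Proof.
apply/seteqP; split.
  have := @closed_julia_Rset R; rewrite closure_id => ->.
  by apply: closureS; exact: subsetUr.
move=> x [xJ|]; last exact: subset_closure.
move=> U; rewrite -nbhs_ballE => -[e /= e0 eU].
have [n ne] := exists_div_exp4_lt 8 e0.
have [y [yz yk xy]] := iter_preimage_approx n xJ (bound4 (mem_head _ _)).
exists y; split; first by apply/RsetP; exists n.
by apply: eU; rewrite /ball /= (le_lt_trans xy).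
Qed.

Lemma renorm_bound_ge (R : realType) (x : R) :
  `|renorm x - 2| <= 4 -> 8 <= (x - 2) ^+ 2.
Proof. by rewrite renormB2 ler_norml; lra. Qed.

(** If [x] reaches 4 at time [n], a nearby [y] is within 1/2 of 4 at that time, so its next iterate
    leaves [[-2, 6]], because [(5/2)^2 < 8]. Such a [y] in the union must have reached 4 by time
    [n], and the finitely many candidates other than [x] are removed. *)
Lemma isolated_Rset (R : realType) (x : R) :
  Rset x -> isolated (@julia R `|` @Rset R) x.
Proof.
move=> xR; split; first by rewrite inE; right.
have /RsetP[n xn] := xR.
pose F := [set y : R | exists2 k, (k < n.+1)%N & iter k (@renorm R) y = 4] `\ x.
exists ((iter n (@renorm R) @^-1` [set y | `|4 - y| < 2^-1]) `&` ~` F).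
  apply: open_nbhs_nbhs; split; last first.
    by split=> [|[_ /(_ erefl)]//]; rewrite /= xn subrr normr0.
  apply: openI.
    apply: open_comp => [y _|]; first exact: continuous_iter_renorm.
    rewrite (_ : [set y | _] = ball (4 : R) 2^-1)//; exact: ball_open.
  rewrite openC; apply: (iffLR accessible_finite_set_closed).
    exact/hausdorff_accessible/Rhausdorff.
  by apply: finite_setD; exact: finite_preimages_below.
apply/seteqP; split=> [y [[/= yn yF] yJR]|_ ->]; last first.
  by split; [split=> [|[_ /(_ erefl)]//]; rewrite /= xn subrr normr0|right].
have far u : iter n (@renorm R) y = u -> `|renorm u - 2| <= 4 -> False.
  move=> yu /renorm_bound_ge; move: yn; rewrite yu ltr_norml => /andP[a b] h.
  have : (u - 2) ^+ 2 <= (5 / 2) ^+ 2 by rewrite ler_sqr ?nnegrE; lra.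
  by rewrite expr2 => ?; lra.
case: yJR => [yJ|/RsetP[m ym]].
  by exfalso; apply: (far _ erefl); rewrite -iterS; exact: yJ.
have [mn|nm] := ltnP m n.+1.
  by apply: contrapT => yx; apply: yF; split; first by exists m.
exfalso; apply: (far _ erefl); rewrite -iterS.
have : iter n.+1 (@renorm R) y \in iter (m - n.+1) (@preimages R) [:: 4].
  by rewrite mem_iter_preimages -?iterD ?subnK ?ym ?inE//; exact: bound4.
by apply: iter_preimages_bound; exact: bound4.
Qed.

Lemma countable_Rset (R : realType) : countable (@Rset R).
Proof.
rewrite (_ : Rset = \bigcup_n [set` iter n (@preimages R) [:: 4]]).
  apply: bigcup_countable => // n _; exact/finite_set_countable/finite_seq.
apply/seteqP; split=> x.
  move=> /RsetP[n xn]; exists n => //=.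
  by rewrite mem_iter_preimages ?xn ?inE//; exact: bound4.
move=> [n _] /=; rewrite mem_iter_preimages; last exact: bound4.
by rewrite inE => /eqP xn; apply/RsetP; exists n.
Qed.

Lemma spectrumE (R : realType) (w : word) :
  [set l : R | in_spectrum w l] = @julia R `|` @Rset R.
Proof.
apply/seteqP; split=> l /=.
  move=> lS; have [[n ln]|lR] := pselect (exists n, iter n (@renorm R) l = 4).
    by right; apply/RsetP; exists n.
  left; apply: contrapT => /julia_escape[n /iter_renorm_large[m]].
  rewrite -iterD => large; apply: lS.
  apply: (@resolvent_iter _ (m + n)); last exact: resolvent_large.
  by move=> k _ lk; apply: lR; exists k.
case=> [lJ|/RsetP[n ln]]; last first.
  by apply: (@spectrum_preimage R n w l ln) => k; exact: iter_renorm_neq4 ln.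
have /choice[mu muP] : forall n, exists y, iter n (@renorm R) y = 4 /\
    `|l - y| <= 8 / 4 ^+ n.
  move=> n.
  have [y [yz _ ly]] := iter_preimage_approx n lJ (bound4 (mem_head _ _)).
  by exists y.
apply: (@spectrum_limit _ w l mu) => n; have [mun lmu] := muP n => //.
by move=> k; exact: (iter_renorm_neq4 mun).
Qed.

(** * Finite Schreier graphs *)

Definition fcons (n : nat) (j : 'I_4) (u : fword n) : fword n.+1 :=
  [ffun m => if unlift ord0 m is Some k then u k else j].

Lemma fcons0 (n : nat) (j : 'I_4) (u : fword n) : fcons j u ord0 = j.
Proof. by rewrite ffunE unlift_none. Qed.

Lemma fconsS (n : nat) (j : 'I_4) (u : fword n) (k : 'I_n) :
  fcons j u (lift ord0 k) = u k.
Proof. by rewrite ffunE liftK. Qed.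

Lemma fcons_eq (n : nat) (j k : 'I_4) (u v : fword n) :
  (fcons j u == fcons k v) = (j == k) && (u == v).
Proof.
apply/eqP/andP => [E|[/eqP -> /eqP ->]//]; split; apply/eqP.
  by have /ffunP/(_ ord0) := E; rewrite !fcons0.
by apply/ffunP => m; have /ffunP/(_ (lift ord0 m)) := E; rewrite !fconsS.
Qed.

Lemma fconsP (n : nat) (u : fword n.+1) : exists j v, u = fcons j v.
Proof.
exists (u ord0), [ffun k => u (lift ord0 k)]; apply/ffunP => m.
by case: (unliftP ord0 m) => [k ->|->]; rewrite ?fcons0// fconsS ffunE.
Qed.

Lemma ef_fcons (n : nat) (i : 'I_3) (j : 'I_4) (u : fword n) :
  ef i (fcons j u) = if j == ord0 then fcons (letter i) (ef i u)
                     else if j == letter i then fcons ord0 u else fcons j u.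
Proof.
apply/ffunP => m; rewrite ffunE.
case: (unliftP ord0 m) => [k ->|->].
  rewrite fconsS.
  have -> : [forall x : 'I_n.+1, (x < lift ord0 k)%N ==> (fcons j u x == ord0)] =
      (j == ord0) && [forall x : 'I_n, (x < k)%N ==> (u x == ord0)].
    apply/forallP/andP => [h|[/eqP -> /forallP h] x].
      split; first by have := h ord0; rewrite fcons0.
      apply/forallP => x; have := h (lift ord0 x).
      by rewrite fconsS.
    case: (unliftP ord0 x) => [y ->|->]; rewrite ?fcons0 ?implybT// fconsS.
    exact: h.
  by case: (eqVneq j ord0) => [_|j0] /=; [rewrite fconsS ffunE|
    case: ifP => _; rewrite fconsS].
have -> : [forall x : 'I_n.+1, (x < (ord0 : 'I_n.+1))%N ==> (fcons j u x == ord0)].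
  by apply/forallP.
by rewrite !fcons0; do 2?case: ifP => _; rewrite fcons0.
Qed.

Lemma ef_inj (n : nat) (i : 'I_3) : injective (@ef n i).
Proof.
elim: n => [|n IH] u v; first by move=> _; apply/ffunP => -[].
have [j [u' ->]] := fconsP u; have [k [v' ->]] := fconsP v.
rewrite !ef_fcons => /eqP E; apply/eqP; move: E.
case: (eqVneq j ord0) => [->|j0]; case: (eqVneq k ord0) => [->|k0].
- by rewrite !fcons_eq !eqxx /= (inj_eq IH).
- case: (eqVneq k (letter i)) => [->|ki]; rewrite fcons_eq //.
  by rewrite eq_sym (negPf ki) /=.
- case: (eqVneq j (letter i)) => [->|ji]; rewrite fcons_eq //.
  by rewrite (negPf ji) /=.
case: (eqVneq j (letter i)) => [->|ji]; case: (eqVneq k (letter i)) => [->|ki] //.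
- by rewrite !fcons_eq !eqxx.
- by rewrite fcons_eq eq_sym (negPf k0) /=.
- by rewrite fcons_eq (negPf j0) /=.
Qed.

Definition schreier (R : realType) (n : nat) (u v : fword n) : R :=
  \sum_(i < 3) ((ef i u == v)%:R + (ef i v == u)%:R).

(** Allows the words to be listed by first letter instead of in the enumeration order of [An]; the
    signs of the row and column permutations cancel. *)
Lemma det_reindex (K : comNzRingType) (T : finType) (m : nat) (h : 'I_m -> T)
    (F : T -> T -> K) : bijective h ->
  \det (\matrix_(a < m, b < m) F (h a) (h b)) =
  \det (\matrix_(a < #|T|, b < #|T|) F (enum_val a) (enum_val b)).
Proof.
move=> hb; have mT : m = #|T| by rewrite -(card_ord m); exact: bij_eq_card hb.
subst m; pose s := perm (inj_comp (@enum_rank_inj T) (bij_inj hb)).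
set A := \matrix_(a, b) F (enum_val a) (enum_val b).
have -> : \matrix_(a, b) F (h a) (h b) = row_perm s (col_perm s A).
  by apply/matrixP => a b; rewrite !mxE !permE /= !enum_rankK.
by rewrite row_permE col_permE !det_mulmx !det_perm odd_permV mulrCA -signr_addb addbb mulr1.
Qed.

Lemma char_poly_AnE (R : realType) (n : nat) : char_poly (@An R n) =
  \det (\matrix_(a < #|{: fword n}|, b < #|{: fword n}|)
    ('X *+ (enum_val a == enum_val b) - (schreier R (enum_val a) (enum_val b))%:P)).
Proof.
congr (\det _); apply/matrixP => a b; rewrite !mxE.
by rewrite (inj_eq enum_val_inj).
Qed.

(** The block of the adjacency matrix of level [n.+1] between the words [0u] and the words [iv], the
    latter indexed by pairs of [i] and [v]. *)
Definition incidence (R : realType) (n : nat) :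
    'M[{poly R}]_(#|{: fword n}|, #|{: 'I_3 * fword n}|) :=
  \matrix_(a, b) ((ef (enum_val b).1 (enum_val a) == (enum_val b).2)%:R
                  + (enum_val a == (enum_val b).2)%:R).

Lemma sum_natr_eq (K : pzSemiRingType) (T : finType) (x : T) (G : T -> K) :
  \sum_(y : T) (x == y)%:R * G y = G x.
Proof.
rewrite (bigD1 x)//= eqxx mul1r big1 ?addr0// => y yx.
by rewrite eq_sym (negPf yx) mul0r.
Qed.

(** The product counts two-step walks between words starting with [0]: each generator contributes
    two returns, six in all, and one edge in each direction of the graph of level [n]. *)
Lemma incidence_mul_tr (R : realType) (n : nat) :
  incidence R n *m (incidence R n)^T =
  \matrix_(a, b) (6 *+ (enum_val a == enum_val b)
    + (schreier R (enum_val a) (enum_val b))%:P).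
Proof.
apply/matrixP => a b; rewrite !mxE.
under eq_bigr => c _ do rewrite !mxE.
move: (enum_val a) (enum_val b) => u v.
pose G (i : 'I_3) (x : fword n) : {poly R} :=
  ((ef i u == x)%:R + (u == x)%:R) * ((ef i v == x)%:R + (v == x)%:R).
transitivity (\sum_(c in {: 'I_3 * fword n}) G c.1 c.2).
  by rewrite [RHS]big_enum_val.
rewrite (eq_bigl xpredT)// -(pair_bigA _ G) /G.
rewrite /schreier rmorph_sum /= (_ : 6 *+ (u == v) = \sum_(i < 3) (2 *+ (u == v))).
  rewrite -big_split; apply: eq_bigr => i _ /=.
  under eq_bigr do rewrite mulrDl.
  rewrite big_split !sum_natr_eq rmorphD !rmorph_nat (inj_eq (@ef_inj n i)).
  rewrite !(eq_sym v u) (eq_sym v (ef i u)).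
  rewrite [X in _ + X = _]addrC addrACA.
  by case: (u == v); rewrite /= ?mulr1n ?mulr0n ?add0r.
by rewrite sumr_const card_ord; case: (u == v); rewrite /= ?mul0rn// mulr1n; ring.
Qed.

Lemma bijective_block (n : nat) : bijective
  (fun a : 'I_(#|{: fword n}| + #|{: 'I_3 * fword n}|) =>
   match fintype.split a with
   | inl b => fcons ord0 (enum_val b)
   | inr b => fcons (letter (enum_val b).1) (enum_val b).2
   end).
Proof.
exists (fun u : fword n.+1 => let v : fword n := [ffun k => u (lift ord0 k)] in
  match unlift ord0 (u ord0) with
  | Some i => rshift _ (enum_rank (i, v))
  | None => lshift _ (enum_rank v)
  end) => [a|u] /=.
  have fK j (v : fword n) : [ffun k => fcons j v (lift ord0 k)] = v :> fword n.
    by apply/ffunP => k; rewrite ffunE fconsS.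
  case: fintype.splitP => b ab; rewrite fcons0 fK ?unlift_none ?liftK;
    apply/val_inj; rewrite /= ?enum_valK ?ab//.
  by rewrite -surjective_pairing enum_valK.
have [j [v ->]] := fconsP u; rewrite fcons0.
have -> : [ffun k => fcons j v (lift ord0 k)] = v :> fword n.
  by apply/ffunP => k; rewrite ffunE fconsS.
case: (unliftP ord0 j) => [i ->|->].
  by rewrite (unsplitK (inr _)) enum_rankK.
by rewrite (unsplitK (inl _)) enum_rankK.
Qed.

(** The block on nonzero first letters is the scalar 4, coming from loops only; this makes the Schur
    complement explicit. *)
Lemma schreier_fcons (R : realType) (n : nat) (u v : fword n) (i j : 'I_3) :
  [/\ schreier R (fcons ord0 u) (fcons ord0 v) = 0,
      schreier R (fcons ord0 u) (fcons (letter j) v) =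
        (ef j u == v)%:R + (u == v)%:R,
      schreier R (fcons (letter i) u) (fcons ord0 v) =
        (ef i v == u)%:R + (v == u)%:R &
      schreier R (fcons (letter i) u) (fcons (letter j) v) =
        4 *+ ((i, u) == (j, v))].
Proof.
have S0l (x y : fword n) (k : 'I_3) :
    schreier R (fcons ord0 x) (fcons (letter k) y) =
      (ef k x == y)%:R + (x == y)%:R.
  rewrite /schreier (bigD1 k)//= big1 ?addr0 => [|m mk].
    by rewrite !ef_fcons !eqxx letter_neq0 !fcons_eq !eqxx /= (eq_sym y).
  have km : (k == m) = false by rewrite eq_sym (negPf mk).
  rewrite !ef_fcons eqxx letter_neq0 (inj_eq letter_inj) km.
  by rewrite !fcons_eq (inj_eq letter_inj) (negPf mk) letter_neq0 addr0.
split=> //.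
- by rewrite /schreier big1// => k _; rewrite !ef_fcons eqxx !fcons_eq addr0.
- by rewrite -S0l /schreier; apply: eq_bigr => k _; rewrite addrC.
rewrite /schreier xpair_eqE.
case: (eqVneq i j) => [<-|ij] /=.
  rewrite (bigD1 i)//= !ef_fcons letter_neq0 eqxx !fcons_eq !(eq_sym ord0) letter_neq0 add0r.
  rewrite (eq_bigr (fun=> 2 *+ (u == v))) => [|k ki].
    rewrite sumr_const cardC1 card_ord /= add0r.
    by case: (u == v); rewrite ?mul0rn// !mulr1n; ring.
  have ik : (i == k) = false by rewrite eq_sym (negPf ki).
  rewrite !ef_fcons letter_neq0 (inj_eq letter_inj) ik !fcons_eq eqxx /=.
  by rewrite (eq_sym v); case: (u == v); rewrite ?addr0//.
have ji : (j == i) = false by rewrite eq_sym (negPf ij).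
rewrite big1// => k _; rewrite !ef_fcons !letter_neq0 !(inj_eq letter_inj).
by case: ifP => _; case: ifP => _;
  rewrite !fcons_eq ?(inj_eq letter_inj) ?(negPf ij) ?ji ?addr0.
Qed.

Lemma char_poly_An_rec (R : realType) (n : nat) : char_poly (@An R n.+1) =
  ('X - 4%:P) ^+ (2 * 4 ^ n) *
  (char_poly (@An R n) \Po ('X^2 - 4%:P * 'X - 6%:P)).
Proof.
pose F (u v : fword n.+1) : {poly R} := 'X *+ (u == v) - (schreier R u v)%:P.
rewrite char_poly_AnE; have <- := det_reindex F (bijective_block n).
set N := #|{: fword n}|; set M := #|{: 'I_3 * fword n}|.
pose Y : {poly R} := 'X - 4%:P.
set A := (X in \det X).
have AE : A = block_mx 'X%:M (- incidence R n) (- (incidence R n)^T) Y%:M.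
  rewrite -[LHS]submxK; congr block_mx; apply/matrixP => a b; rewrite !mxE /F;
    rewrite ?(unsplitK (inl _)) ?(unsplitK (inr _)).
  - have [-> _ _ _] := schreier_fcons R (enum_val a) (enum_val b) ord0 ord0.
    by rewrite subr0 fcons_eq eqxx (inj_eq enum_val_inj).
  - have [_ -> _ _] := schreier_fcons R (enum_val a) (enum_val b).2 ord0 (enum_val b).1.
    by rewrite fcons_eq mulr0n sub0r rmorphD !rmorph_nat.
  - have [_ _ -> _] := schreier_fcons R (enum_val a).2 (enum_val b) (enum_val a).1 ord0.
    by rewrite fcons_eq mulr0n sub0r rmorphD !rmorph_nat.
  have [_ _ _ ->] := schreier_fcons R (enum_val a).2 (enum_val b).2
    (enum_val a).1 (enum_val b).1.
  rewrite fcons_eq (inj_eq letter_inj) -xpair_eqE -!surjective_pairing.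
  rewrite (inj_eq enum_val_inj) /Y.
  by case: (a == b); rewrite ?mulr1n ?mulr0n// subr0.
(* Right multiplication by [L] makes [A] block triangular. *)
pose L := block_mx Y%:M 0 (incidence R n)^T (1%:M : 'M[{poly R}]_M).
have detAL : \det A * Y ^+ N =
    \det (('X * Y)%:M - incidence R n *m (incidence R n)^T) * Y ^+ M.
  have <- : \det L = Y ^+ N by rewrite det_lblock det_scalar det1 mulr1.
  rewrite -det_mulmx AE mulmx_block !mulmx0 !mulmx1 mul_scalar_mx scale_scalar_mx.
  rewrite mul_mx_scalar mul_scalar_mx scalerN addNr add0r mulNmx.
  by rewrite add0r det_ublock det_scalar.
(* The matrix is [X^2 - 4X - 6] minus the adjacency matrix: the characteristic matrix of level [n]
   with [renorm] substituted for the variable. *)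
have detE : \det (('X * Y)%:M - incidence R n *m (incidence R n)^T) =
    char_poly (@An R n) \Po ('X^2 - 4%:P * 'X - 6%:P).
  rewrite char_poly_AnE -det_map_mx; congr (\det _); apply/matrixP => a b.
  rewrite incidence_mul_tr !mxE rmorphB rmorphMn /= comp_polyX comp_polyC.
  rewrite (inj_eq enum_val_inj) /Y.
  by case: (a == b); rewrite ?mulr1n ?mulr0n; ring.
have Y0 : Y != 0 by rewrite polyXsubC_eq0.
(* The exponent left after cancelling is [M - N = 3 * 4^n - 4^n]. *)
apply: (mulIf (expf_neq0 N Y0)); rewrite detAL detE mulrAC mulrC; congr (_ * _).
rewrite -exprD; congr (_ ^+ _).
by rewrite /M /N card_prod !card_ffun !card_ord; lia.
Qed.

(** * The spectral measure *)

(** Level 0 is a single vertex with three loops, whence the eigenvalue 6; each next level follows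
    the recursion of the characteristic polynomials. *)
Fixpoint eigs (R : realType) (n : nat) : seq R :=
  if n is m.+1 then nseq (2 * 4 ^ m) 4 ++ preimages (eigs R m) else [:: 6].

Lemma eigsS (R : realType) (n : nat) :
  eigs R n.+1 = nseq (2 * 4 ^ n) 4 ++ preimages (eigs R n).
Proof. by []. Qed.

Lemma eigs_bound (R : realType) (n : nat) :
  {in eigs R n, forall x, `|x - 2| <= 4}.
Proof.
elim: n => [|n IH] x /=.
  by rewrite inE => /eqP ->; rewrite ler_norml; lra.
rewrite mem_cat mem_nseq => /orP[/andP[_ /eqP ->]|].
  by rewrite ler_norml; lra.
exact: preimages_bound.
Qed.

Lemma comp_renorm_XsubC (R : realType) (l : R) : 0 <= 10 + l ->
  ('X - l%:P) \Po ('X^2 - 4%:P * 'X - 6%:P) =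
  ('X - (2 + Num.sqrt (10 + l))%:P) * ('X - (2 - Num.sqrt (10 + l))%:P).
Proof.
move=> l0; rewrite comp_polyB comp_polyX comp_polyC.
have -> : l%:P = (Num.sqrt (10 + l))%:P ^+ 2 - 10%:P.
  by rewrite -rmorphXn -rmorphB /= sqr_sqrtr// addrAC subrr add0r.
rewrite polyCD polyCB; ring.
Qed.

Lemma char_poly_eigs (R : realType) (n : nat) : eigen_list n (eigs R n).
Proof.
rewrite /eigen_list; elim: n => [|n IH].
  have hb : bijective (fun _ : 'I_1 => [ffun=> ord0] : fword 0).
    exists (fun=> ord0) => [x|u]; first by rewrite [x]ord1.
    by apply/ffunP => -[].
  rewrite char_poly_AnE.
  have <- := det_reindex (fun u v : fword 0 => 'X *+ (u == v) - (schreier R u v)%:P) hb.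
  rewrite det_mx11 mxE big_seq1 eqxx mulr1n /schreier; congr (_ - _%:P).
  have ef0 i : ef i [ffun=> ord0] = [ffun=> ord0] :> fword 0.
    by apply/ffunP => -[].
  rewrite (eq_bigr (fun=> 2)) => [|i _]; last by rewrite !ef0 eqxx.
  rewrite sumr_const card_ord; ring.
rewrite char_poly_An_rec IH eigsS big_cat big_nseq iter_mulr_1; congr (_ * _).
rewrite rmorph_prod; have := @eigs_bound R n.
elim: (eigs R n) => [|l s IHs] sb; first by rewrite /preimages !big_nil.
rewrite preimages_cons !big_cons IHs => [|x xs]; last first.
  by apply: sb; rewrite inE xs orbT.
rewrite /= mulrA; congr (_ * _); apply: comp_renorm_XsubC.
by have := sb l (mem_head _ _); rewrite ler_norml; lra.
Qed.

Lemma sum_preimages (R : realType) (s : seq R) (f : R -> R) :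
  \sum_(x <- preimages s) f x =
  \sum_(l <- s) (f (2 + Num.sqrt (10 + l)) + f (2 - Num.sqrt (10 + l))).
Proof.
elim: s => [|l s IH]; first by rewrite !big_nil.
by rewrite preimages_cons !big_cons IH addrA.
Qed.

(** The copies of 4 pulled back [k] times number [2 * 4^(n-1-k)] per preimage, which gives the
    weight [1 / (2 * 4^k)]. The remainder, carried by the [2^n] preimages of 6, has mass [2^-n]. *)
Lemma sum_eigs (R : realType) (n : nat) (f : R -> R) :
  (4 ^+ n)^-1 * \sum_(x <- eigs R n) f x =
  \sum_(k < n) (\sum_(x <- iter k (@preimages R) [:: 4]) f x) / (2 * 4 ^+ k)
  + (\sum_(x <- iter n (@preimages R) [:: 6]) f x) / 4 ^+ n.
Proof.
elim: n f => [|n IH] f; first by rewrite big_ord0 add0r mulrC.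
rewrite eigsS big_cat /= sum_preimages mulrDr exprS invfM -[X in _ + X]mulrA IH.
rewrite big_ord_recl /= mulrDr addrA; congr (_ + _ + _).
- rewrite big_nseq iter_addr_0 big_seq1 expr0 mulr1 -[X in _ * X]mulr_natr.
  rewrite natrM natrX; field.
  by rewrite expf_neq0.
- rewrite mulr_sumr; apply: eq_bigr => k _.
  rewrite sum_preimages exprS; field.
  by rewrite expf_neq0.
- rewrite sum_preimages; field.
  by rewrite expf_neq0.
Qed.

Lemma sum_iter_preimages_le (R : realType) (k : nat) (z M : R) (f : R -> R) :
  (forall x, `|f x| <= M) ->
  `|\sum_(x <- iter k (@preimages R) [:: z]) f x| / 4 ^+ k <= M * 2^-1 ^+ k.
Proof.
move=> fM; rewrite ler_pdivrMr ?exprn_gt0//.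
have -> : M * 2^-1 ^+ k * 4 ^+ k = M * (2 ^ k)%:R.
  by rewrite -mulrA -exprMn natrX (_ : 2^-1 * 4 = 2)//; field.
apply: (le_trans (ler_norm_sum _ _ _)).
apply: (@le_trans _ _ (\sum_(x <- iter k (@preimages R) [:: z]) M)).
  by apply: ler_sum.
rewrite big_const_seq count_predT iter_addr_0 size_iter_preimages muln1.
by rewrite mulr_natr.
Qed.

Lemma kns_limit (R : realType) (f : R -> R) (M : R) :
  (forall x, `|f x| <= M) ->
  (4 ^+ n)^-1 * \sum_(x <- eigs R n) f x @[n --> \oo] --> kns_int f.
Proof.
move=> fM; have M0 : 0 <= M := le_trans (normr_ge0 _) (fM 0).
pose a k := (\sum_(x <- iter k (@preimages R) [:: 4]) f x) / (2 * 4 ^+ k).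
pose b n := (\sum_(x <- iter n (@preimages R) [:: 6]) f x) / 4 ^+ n.
pose T N := \sum_(1 <= n < N) (\sum_(x <- @Rn R n) f x) / (2 * 4 ^+ n).
(* The sum in [kns_int] starts at level 1, whereas [series] starts at index 0. Level [k] has [2^k]
   points, so the terms decay geometrically. *)
have TS : (fun n => T n.+1) = series (fun k => a k.+1).
  apply/funext => n; rewrite /T /series /= big_add1 /=.
  by apply: eq_bigr => k _; rewrite Rn_iter.
have q1 : `|2^-1 : R| < 1 by rewrite ger0_norm; lra.
have cT : T n @[n --> \oo] --> limn T.
  suff : cvgn (fun n => T n.+1).
    by move=> /cvg_ex[l]; rewrite (cvg_shiftS T) => Tl; apply/cvg_ex; exists l.
  rewrite TS; apply: normed_cvg.
  apply: (@series_le_cvg _ _ (geometric M 2^-1)) => [n|n|n|].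
  - exact: normr_ge0.
  - by rewrite /geometric /= mulr_ge0// exprn_ge0.
  - rewrite /geometric /= /a normrM normfV [`|2 * _|]ger0_norm ?mulr_ge0 ?exprn_ge0//.
    have h := @sum_iter_preimages_le R n.+1 4 M f fM.
    rewrite invfM mulrCA; apply: (@le_trans _ _ (2^-1 * (M * 2^-1 ^+ n.+1))).
      by rewrite ler_wpM2l.
    have t0 : 0 <= M * 2^-1 ^+ n by rewrite mulr_ge0// exprn_ge0.
    by rewrite exprS; lra.
  exact: is_cvg_geometric_series.
have cb : b n @[n --> \oo] --> (0 : R).
  apply/norm_cvg0P; apply: (squeeze_cvgr _ (cvg_cst 0) (cvg_geometric M q1)).
  near=> n; rewrite normr_ge0 /= /b normrM normfV [`|4 ^+ _|]ger0_norm ?exprn_ge0//.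
  exact: sum_iter_preimages_le.
rewrite -(cvg_shiftS (fun n => (4 ^+ n)^-1 * \sum_(x <- eigs R n) f x)).
rewrite (_ : [sequence _]_n = fun n => f 4 / 2 + T n.+1 + b n.+1); last first.
  apply/funext => n; rewrite [LHS]sum_eigs big_ord_recl big_seq1 expr0 mulr1; congr (_ + _ + _).
  by rewrite [T _](congr1 (@^~ n) TS) /series /= big_mkord.
rewrite -[kns_int f]addr0; apply: cvgD; last by rewrite (cvg_shiftS b).
by apply: cvgD; [exact: cvg_cst|rewrite (cvg_shiftS T)].
Unshelve. all: by end_near. Qed.

Theorem theorem3p7 (R : realType) (w : word) (Hinf : ~ finite_set (sorbit w)) :
  (* spectrum of the infinite Schreier graph *)
  [set l : R | in_spectrum w l] = closure (@Rset R)
  /\ (* Cantor part + countable isolated part supporting mu *)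
  (exists C I : set R,
     [set l : R | in_spectrum w l] = C `|` I
     /\ cantor_set C
     /\ measurable C /\ lebesgue_measure C = 0%E
     /\ (forall x, C x -> C (4 - x))
     /\ countable I
     /\ (forall x, I x -> isolated [set l : R | in_spectrum w l] x)
     /\ (@Rset R `<=` I))
  /\ (* the atoms are distinct, so mu({x}) = 1/(2*4^n) for x in R_n, mu({4}) = 1/2 *)
  (forall n, (1 <= n)%N -> uniq (@Rn R n) /\ (4 : R) \notin @Rn R n)
  /\ (forall n m, (1 <= n)%N -> (n < m)%N -> forall x : R, x \in Rn n -> x \notin Rn m)
  /\ (* the eigenvalue lists of A_n exist *)
  (forall n, exists s : seq R, eigen_list n s)
  /\ (* KNS: weak convergence of mu_n to mu *)
  (forall f : R -> R, continuous f -> (exists M : R, forall x, `|f x| <= M) ->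
     forall s : nat -> seq R, (forall n, eigen_list n (s n)) ->
       (fun n => (4 ^+ n)^-1 * \sum_(x <- s n) f x) @ \oo --> kns_int f).
Proof.
split; first by rewrite spectrumE closure_Rset.
split.
  exists (@julia R), (@Rset R); rewrite spectrumE; split=> //.
  split; first exact: cantor_julia.
  split; first by apply: measurable_realfun.closed_measurable; exact: closed_julia.
  split; first exact: lebesgue_julia.
  split; first exact: julia_symmetric.
  split; first exact: countable_Rset.
  by split=> //; exact: isolated_Rset.
split=> [[//|n] _|].
  split; first exact: uniq_Rn.
  rewrite mem_Rn; apply/eqP => E; have := @iter_renorm4 R n.+1 isT.
  by rewrite E ger0_norm => [?|]; lra.
split=> [[//|n] [//|m] _ nm x|].
  rewrite !mem_Rn => /eqP xn; apply/eqP => xm.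
  by move: nm; rewrite (iter_renorm_inj4 xn xm) ltnn.
split=> [n|]; first by exists (eigs R n); exact: char_poly_eigs.
move=> f _ [M fM] s sE.
(* Two lists of roots of the same characteristic polynomial are permutations of each other, so [s n]
   may be replaced by [eigs R n]. *)
under eq_fun => n.
  rewrite (perm_big (eigs R n)); last first.
    by apply: prod_XsubC_eq; rewrite -sE; exact: char_poly_eigs.
  over.
exact: kns_limit fM.
Qed.
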